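(* Let $D$ be a directed graph of even order $n$. If $\delta(D) > \frac{25}{48}n$, then $D$ contains an anti-directed 2-factor.
   Context: A directed graph $D$ has a finite nonempty vertex set $V(D)$ and a set $A(D)$ of arcs, which are ordered pairs of distinct vertices; there are no loops and no repeated arcs, but both $(u,v)$ and $(v,u)$ may be arcs. The order of $D$ is $n=|V(D)|$. For $v\in V(D)$, $d^{+}(v,D)$ is the number of arcs directed out of $v$, $d^{-}(v,D)$ is the number of arcs directed into $v$, and $\delta(D)=\min_{v\in V(D)}\min\{d^{+}(v,D),d^{-}(v,D)\}$. The multigraph underlying $D$ is obtained by ignoring the directions of the arcs (so a pair of opposite arcs gives two parallel edges). An anti-directed cycle in $D$ is a cycle in the multigraph underlying $D$ such that no pair of (cyclically) consecutive arcs of the cycle forms a directed path in $D$; that is, at every vertex of the cycle the two arcs of the cycle incident with it are either both directed into it or both directed out of it. In particular a pair of opposite arcs $(u,v),(v,u)$ is not an anti-directed cycle. An anti-directed 2-factor in $D$ is a collection of vertex-disjoint anti-directed cycles in $D$ that together span $V(D)$. *)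

(* Defs.v *)
From mathcomp Require Import all_boot all_order all_algebra.
Set Implicit Arguments.
Unset Strict Implicit.
Unset Printing Implicit Defensive.

Record digraph := Digraph {
  vertex :> finType;
  arc : rel vertex;
  arc_irrefl : irreflexive arc;
  vertex_gt0 : 0 < #|vertex|
}.

Section Digraph.
Variable D : digraph.

Definition outdeg (v : D) : nat := #|[set w | arc v w]|.
Definition indeg (v : D) : nat := #|[set u | arc u v]|.

(* Every degree is at most #|D|, and D is nonempty, so the default value #|D|
   of the iterated minimum does not affect the result. *)
Definition min_semidegree : nat :=
  \big[minn/#|D|]_(v : D) minn (outdeg v) (indeg v).

(* The arc e = (tail, head) is, with its direction ignored, an edge uv. *)
Definition joins (u v : D) (e : D * D) : bool :=
  (e == (u, v)) || (e == (v, u)).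

(* A cycle of the underlying multigraph: distinct vertices v_0, ..., v_(k-1)
   and distinct arcs e_0, ..., e_(k-1) with k >= 2, where e_i joins v_i to
   v_(i+1 mod k). The edges are recorded as arcs because opposite arcs are
   different parallel edges, so a cycle may have length 2. *)
Definition multigraph_cycle (c : seq D * seq (D * D)) : bool :=
  let: (vs, es) := c in
  [&& 2 <= size vs, uniq vs, uniq es,
      all (fun e => arc e.1 e.2) es &
      all2 (fun uv e => joins uv.1 uv.2 e) (zip vs (rot 1 vs)) es].

Definition directed_path2 (e f : D * D) : bool :=
  (e.2 == f.1) || (f.2 == e.1).

Definition antidirected_cycle (c : seq D * seq (D * D)) : bool :=
  multigraph_cycle c &&
  all2 (fun e f => ~~ directed_path2 e f) c.2 (rot 1 c.2).

(* Uniqueness of the concatenated vertex lists expresses that the cycles are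
   pairwise vertex-disjoint. *)
Definition antidirected_2factor (cs : seq (seq D * seq (D * D))) : bool :=
  [&& all antidirected_cycle cs,
      uniq (flatten [seq c.1 | c <- cs]) &
      [forall v : D, v \in flatten [seq c.1 | c <- cs]]].

End Digraph.

(* Main.v *)
From Stdlib Require Import NArith.
Require Import Defs.
From mathcomp Require Import all_boot all_order all_algebra.
From mathcomp Require Import zify.
Set Implicit Arguments.
Unset Strict Implicit.
Unset Printing Implicit Defensive.

(* Let n = 2m and let X, Y be the two halves of a balanced partition of V. An
   anti-directed 2-factor with sources X and sinks Y is a 2-factor of the
   bipartite graph of the arcs X -> Y, and by Hall's theorem it exists unless
   e(S,T) < 2(|S| + |T| - m) for some S in X, T in Y. A minimal such pair has at
   most one arc between a vertex and the other set, so S consists of vertices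
   with at most m - |T| + 1 out-neighbours in Y, and T of vertices with at most
   m - |S| + 1 in-neighbours in X. For suitable weights phi, roughly
   phi(k) = 1/(k+1) for k < m/2 and 0 above, every obstructed X therefore
   satisfies Phi(X) := sum_{x in X} phi(d+_Y(x)) + sum_{y in Y} phi(d-_X(y)) >= 1.
   For uniformly random X these degrees are hypergeometric, and the mean of Phi is
   below 1 except for m = 23 (1.0306) and m = 47 (1.005).

   For these two orders, a smaller weight at k = (m-1)/2 has mean below 1 and is
   still at least 1 at every obstructed X except those for which |S| = |T| =
   (m+1)/2 and e(S,T) <= 1; so such a pair (S,T) exists in D. Now choose X at
   random among the sets that contain exactly half of S, half of T and half of
   the rest. The out-degrees from S and the in-degrees to T have a smaller
   variance for this distribution, which brings the mean of Phi below 1. *)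

(** * Hall's theorem and 2-factors of bipartite graphs *)

Section Hall.
Variables L R : finType.
Implicit Types (r : L -> R -> bool) (A B : {set L}).

Definition nbh r B : {set R} := \bigcup_(x in B) [set y | r x y].

Lemma nbhP r B y : reflect (exists2 x, x \in B & r x y) (y \in nbh r B).
Proof.
by apply: (iffP bigcupP) => -[x xB]; rewrite ?inE => rxy; exists x; rewrite ?inE.
Qed.

Lemma nbhU r A B : nbh r (A :|: B) = nbh r A :|: nbh r B.
Proof.
apply/setP => y; rewrite in_setU; apply/nbhP/orP.
  by case=> x /setUP[] xA rxy; [left|right]; apply/nbhP; exists x.
by case=> /nbhP[x xA rxy]; exists x => //; rewrite inE xA ?orbT.
Qed.

Lemma nbh_avoid r (C : {set R}) B :
  nbh (fun x y => r x y && (y \notin C)) B = nbh r B :\: C.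
Proof.
apply/setP => y; rewrite in_setD; apply/nbhP/andP.
  by case=> x xB /andP[rxy yC]; split=> //; apply/nbhP; exists x.
by case=> yC /nbhP[x xB rxy]; exists x => //; rewrite rxy.
Qed.

(** Induction on the size of [A]. If some nonempty proper subset [B] is tight, [B] and [A :\: B] are
    matched separately, the latter outside [nbh r B]. Otherwise any edge at [x] can be used and its
    end removed, since every nonempty proper subset has a neighbour to spare. *)
Lemma hall (y0 : R) r A :
  (forall B : {set L}, B \subset A -> #|B| <= #|nbh r B|) ->
  exists f : L -> R, {in A &, injective f} /\ {in A, forall x, r x (f x)}.
Proof.
have [n] := ubnP #|A|; elim: n r A => // n IH r A.
rewrite ltnS => leAn HA.
have [->|[x xA]] := set_0Vmem A.
  by exists (fun=> y0); split=> x; rewrite inE.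
case: (boolP [exists B : {set L}, [&& B \proper A, B != set0 & #|nbh r B| == #|B|]]).
  case/existsP => B /and3P[BA B0 /eqP tight].
  have sBA := proper_sub BA.
  have [f1 [f1i f1r]] := IH r B (leq_trans (proper_card BA) leAn)
    (fun C sC => HA C (subset_trans sC sBA)).
  have ltAB : #|A :\: B| < n.
    apply: leq_trans leAn; apply: proper_card.
    rewrite properE subsetDl /=; apply/subsetPn.
    case/set0Pn: B0 => z zB; exists z; first exact: (subsetP sBA).
    by rewrite inE zB.
  have [|f2 [f2i f2r]] := IH (fun x y => r x y && (y \notin nbh r B)) (A :\: B) ltAB.
    move=> C sC; have sCA := subset_trans sC (subsetDl A B).
    rewrite nbh_avoid.
    have := HA (B :|: C); rewrite subUset sBA sCA => /(_ isT).
    have BC0 : B :&: C = set0.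
      apply/setP=> z; rewrite !inE; case: (boolP (z \in C)); rewrite ?andbF //.
      by move/(subsetP sC); rewrite inE andbT => /andP[/negPf].
    rewrite nbhU cardsU BC0 cards0 subn0 -tight => le.
    have := leq_card_setU (nbh r B) (nbh r C :\: nbh r B).
    rewrite (_ : _ :|: _ = nbh r B :|: nbh r C) => [[le2 _]|].
      by rewrite -(leq_add2l #|nbh r B|) (leq_trans le).
    by apply/setP=> z; rewrite !in_setU in_setD; case: (z \in nbh r B).
  exists (fun x => if x \in B then f1 x else f2 x).
  have f2B w : w \in A -> w \notin B -> r w (f2 w) /\ f2 w \notin nbh r B.
    by move=> wA wB; apply/andP/f2r; rewrite inE wB.
  split.
    have key z w : z \in B -> w \in A -> w \notin B -> f1 z = f2 w -> False.
      move=> zB wA wB E; have [_ /nbhP[]] := f2B w wA wB.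
      by exists z; rewrite // -E f1r.
    move=> z w zA wA; case: (boolP (z \in B)) => zB; case: (boolP (w \in B)) => wB E.
    - exact: f1i.
    - by case: (key z w).
    - by case: (key w z).
    - by apply: f2i => //; rewrite inE ?zB ?wB.
  by move=> z zA; case: ifPn => zB; [exact: f1r | case: (f2B z)].
rewrite negb_exists => /forallP noT.
have [y rxy] : exists y, r x y.
  have := HA [set x]; rewrite sub1set xA cards1 => /(_ isT) /card_gt0P[y].
  by case/nbhP => z /set1P-> rz; exists y.
have ltA : #|A :\ x| < n by apply: leq_trans leAn; rewrite (cardsD1 x A) xA.
have [|f [fi fr]] := IH (fun z w => r z w && (w \notin [set y])) (A :\ x) ltA.
  move=> C sC; have [->|C0] := eqVneq C set0; first by rewrite cards0.
  have CA : C \proper A.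
    apply/properP; split; first exact: subset_trans sC (subsetDl _ _).
    by exists x => //; apply/negP => /(subsetP sC); rewrite !inE eqxx.
  have := noT C; rewrite CA C0 /= => neq.
  have := HA C (proper_sub CA); rewrite leq_eqVlt eq_sym (negPf neq) /= nbh_avoid.
  by rewrite (cardsD1 y (nbh r C)); case: (y \in _) => //= /ltnW.
exists (fun z => if z == x then y else f z).
have fy z : z \in A -> z != x -> r z (f z) /\ f z != y.
  by move=> zA zx; rewrite -in_set1; apply/andP/fr; rewrite !inE zx.
split.
  move=> z w zA wA; case: eqP => [->|/eqP zx]; case: eqP => [->|/eqP wx] //.
  - by move=> E; have [_] := fy w wA wx; rewrite -E eqxx.
  - by move=> E; have [_] := fy z zA zx; rewrite E eqxx.
  - by move=> E; apply: fi => //; rewrite !inE ?zx ?wx.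
by move=> z zA; case: eqP => [->//|/eqP zx]; case: (fy z).
Qed.

End Hall.

Section TwoFactor.
Variable V : finType.
Implicit Types (e : rel V) (X S T : {set V}).

Definition arcs e S T : {set V * V} := [set p | [&& p.1 \in S, p.2 \in T & e p.1 p.2]].

Lemma card_fibers (U W : finType) (h : U -> W) (P : {set U}) (B : {set W}) :
  \sum_(b in B) #|[set p in P | h p == b]| = #|[set p in P | h p \in B]|.
Proof.
rewrite -sum1_card (partition_big h (mem B)) /=; last by move=> p; rewrite inE => /andP[].
apply: eq_bigr => b bB; rewrite -sum1_card; apply: eq_bigl => p; rewrite !inE.
by case: eqP => [->|]; rewrite ?bB ?andbT ?andbF.
Qed.

(** Double counting gives Hall's condition: at least [k * #|B|] pairs of [P] leave [B], and each
    neighbour of [B] receives at most [k] of them. *)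
Lemma regular_matching (P : {set V * V}) X k : 0 < k ->
  (forall x, x \in X -> k <= #|[set p in P | p.1 == x]|) ->
  (forall y, #|[set p in P | p.2 == y]| <= k) ->
  exists f : V -> V, {in X &, injective f} /\ {in X, forall x, (x, f x) \in P}.
Proof.
move=> k0 outP inP; have [->|[x0 _]] := set_0Vmem X.
  by exists id; split=> x; rewrite inE.
have [B BX|f [fi fP]] := @hall _ _ x0 (fun x y => (x, y) \in P) X; last by exists f; split.
rewrite -(leq_pmul2l k0) mulnC -sum_nat_const.
apply: (@leq_trans (\sum_(x in B) #|[set p in P | p.1 == x]|)).
  by apply: leq_sum => x /(subsetP BX); apply: outP.
rewrite card_fibers mulnC -sum_nat_const.
apply: (@leq_trans (\sum_(y in nbh (fun x y => (x, y) \in P) B) #|[set p in P | p.2 == y]|)).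
  rewrite card_fibers; apply: subset_leq_card; apply/subsetP => -[x y].
  by rewrite !in_set /= => /andP[xyP xB]; rewrite xyP /=; apply/nbhP; exists x.
by apply: leq_sum.
Qed.

Lemma card_sumType (U W : finType) (B : {set U + W}) :
  #|B| = #|[set u | inl u \in B]| + #|[set w | inr w \in B]|.
Proof.
rewrite -!sum1_card big_sumType /=.
by congr (_ + _); apply: eq_bigl => z; rewrite inE.
Qed.

Lemma card_pair_bool (B : {set V * bool}) (S : {set V}) :
  (forall x b, (x, b) \in B -> x \in S) -> #|B| <= 2 * #|S|.
Proof.
move=> BS; apply: leq_trans (_ : #|setX S [set: bool]| <= _).
  by apply/subset_leq_card/subsetP => -[x b] /BS xS; rewrite !inE xS.
by rewrite cardsX cardsT card_bool mulnC.
Qed.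

(* A unit-capacity edge p is encoded by two nodes, one on each side of the
   bipartite graph: matching them to each other leaves p unused, and otherwise
   both are matched to copies of the endpoints of p. *)
Definition gadget (E : {set V * V}) (a b : V * bool + V * V) : bool :=
  match a, b with
  | inl (x, _), inr p => (p \in E) && (p.1 == x)
  | inr p, inr q => p == q
  | inr p, inl (y, _) => p.2 == y
  | inl _, inl _ => false
  end.

(** Hall's theorem is applied to [gadget]. When a copy of [x] is matched to [p], the left node of
    [p] is forced onto a copy of its head; the arcs whose two nodes are not matched to each other
    form [P]. *)
Lemma degree_two_subgraph e X :
  (forall S T, S \subset X -> T \subset ~: X ->
     2 * (#|S| + #|T|) <= #|arcs e S T| + 2 * #|~: X|) ->
  exists P : {set V * V}, [/\ P \subset arcs e X (~: X),
    forall x, x \in X -> 2 <= #|[set p in P | p.1 == x]| &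
    forall y, #|[set p in P | p.2 == y]| <= 2].
Proof.
move=> HST; set E := arcs e X (~: X).
have [->|[x0 _]] := set_0Vmem X.
  exists set0; split=> [|x|y]; rewrite ?sub0set ?inE //.
  by rewrite (_ : [set _ in _ | _] = set0) ?cards0 //; apply/setP=> p; rewrite !inE.
pose A := [set a : V * bool + V * V |
  match a with inl (x, _) => x \in X | inr p => p \in E end].
have [|f [fi fr]] := @hall _ _ (inl (x0, true)) (gadget E) A.
  move=> B BA.
  pose S := [set x | (inl (x, true) \in B) || (inl (x, false) \in B)].
  pose Q := [set p : V * V | inr p \in B].
  (* [T] collects the sinks that no arc of [Q] enters. The arcs from [S] to [T] thus lie outside
     [Q], and they are neighbours of [B]; the hypothesis on [S] and [T] counts them. *)
  pose T := [set y in ~: X | [forall p in Q, p.2 != y]].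
  have SX : S \subset X.
    by apply/subsetP=> x; rewrite inE => /orP[] /(subsetP BA); rewrite inE.
  have TX : T \subset ~: X by apply/subsetP=> y; rewrite inE => /andP[].
  have leB : #|B| <= 2 * #|S| + #|Q|.
    rewrite card_sumType leq_add2r; apply: card_pair_bool => x b; rewrite !inE.
    by case: b => ->; rewrite ?orbT.
  have leR : #|Q :|: arcs e S T| <= #|[set p | inr p \in nbh (gadget E) B]|.
    apply/subset_leq_card/subsetP => p; rewrite in_setU inE => /orP[pQ|].
      by apply/nbhP; exists (inr p); rewrite /= ?eqxx //; move: pQ; rewrite inE.
    rewrite !inE => /and3P[pS /andP[pX _] ep].
    have pE : p \in E by rewrite inE ep (subsetP SX) ?inE // pX.
    by case/orP: pS => pB; apply/nbhP;
      [exists (inl (p.1, true))|exists (inl (p.1, false))]; rewrite //= pE eqxx.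
  have leL : 2 * #|~: X :\: T| <= #|[set u | inl u \in nbh (gadget E) B]|.
    apply: (@leq_trans #|setX (~: X :\: T) [set: bool]|).
      by rewrite cardsX cardsT card_bool mulnC.
    apply/subset_leq_card/subsetP => -[y b]; rewrite in_setX in_setD => /andP[/andP[yT yX] _].
    move: yT; rewrite inE yX /= negb_forall => /existsP[p]; rewrite negb_imply negbK inE.
    by case/andP=> pB /eqP py; rewrite ?inE; apply/nbhP; exists (inr p); rewrite //= py.
  have dis : #|Q :|: arcs e S T| = #|Q| + #|arcs e S T|.
    rewrite -cardsUI (_ : Q :&: _ = set0) ?cards0 ?addn0 //.
    apply/setP=> p; rewrite in_setI in_set0; apply/negP => /andP[pQ].
    by rewrite inE => /and3P[_]; rewrite inE => /andP[_ /forall_inP/(_ p pQ)]; rewrite eqxx.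
  apply: leq_trans leB _; rewrite (card_sumType (nbh _ _)).
  have := leq_add leL leR; apply: leq_trans; rewrite dis.
  rewrite cardsD (setIidPr TX).
  by have := HST S T SX TX; have := subset_leq_card TX; lia.
pose P := [set p in E | f (inr p) != inr p].
have PE p : p \in P -> p \in E by rewrite inE => /andP[].
have ApE p : p \in E -> inr p \in A by move=> pE; rewrite in_set.
exists P; split; first by apply/subsetP => p; exact: PE.
- move=> x xX.
  have fx b : exists2 p, f (inl (x, b)) = inr p & p \in [set p in P | p.1 == x].
    have xA : inl (x, b) \in A by rewrite inE.
    have := fr _ xA; case E1: (f _) => [//|p] /andP[pE px]; exists p => //.
    rewrite in_set px andbT in_set pE; apply/eqP => E2.
    by have := fi _ _ xA (ApE p pE); rewrite E1 E2 => /(_ erefl).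
  have [p1 f1 p1P] := fx true; have [p2 f2 p2P] := fx false.
  have p12 : p1 != p2.
    apply/eqP => p12; have := fi (inl (x, true)) (inl (x, false)).
    by rewrite !inE xX f1 f2 p12 => /(_ isT isT erefl).
  have := subset_leq_card (_ : [set p1; p2] \subset [set p in P | p.1 == x]).
  by rewrite cards2 p12; apply; rewrite subUset !sub1set p1P.
- move=> y; rewrite -[2]card_bool -cardsT.
  (* The vertex [y] has two copies, and [h] tells which one an arc of [P] occupies. The value [true]
     of the second branch is not reached on [P]. *)
  pose h p := if f (inr p) is inl (_, b) then b else true.
  rewrite -(card_in_imset (f := h)) ?subset_leq_card ?subsetT //.
  move=> p q; rewrite in_set [p \in P]in_set => /andP[/andP[pE pf] /eqP py].
  rewrite in_set [q \in P]in_set => /andP[/andP[qE qf] /eqP qy].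
  move: (fr _ (ApE q qE)) (fr _ (ApE p pE)) pf qf (fi _ _ (ApE p pE) (ApE q qE)); rewrite /h.
  case: (f (inr p)) => [[y1 b1]|p'] /=; case: (f (inr q)) => [[y2 b2]|q'] /=.
  - by rewrite py qy => /eqP<- /eqP<- _ _ inj bb; rewrite bb in inj; case: (inj erefl).
  - by move=> /eqP -> _ _; rewrite eqxx.
  - by move=> _ /eqP->; rewrite eqxx.
  - by move=> _ /eqP->; rewrite eqxx.
Qed.

(** Both sides have the same size, so the first matching covers the complement of [X]. Deleting its
    arcs leaves out-degrees at least 1 on [X] and in-degrees at most 1, hence a second matching. *)
Lemma two_disjoint_matchings e X : #|X| = #|~: X| ->
  (forall S T, S \subset X -> T \subset ~: X ->
     2 * (#|S| + #|T|) <= #|arcs e S T| + 2 * #|~: X|) ->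
  exists f g : V -> V, [/\ {in X &, injective f}, {in X &, injective g} &
    {in X, forall x, [/\ (x, f x) \in arcs e X (~: X), (x, g x) \in arcs e X (~: X) & g x != f x]}].
Proof.
move=> cX HST; have [P [PE outP inP]] := degree_two_subgraph HST.
have [f [fi fP]] := regular_matching (isT : 0 < 2) outP inP.
have fX : [set f x | x in X] = ~: X.
  apply/eqP; rewrite eqEcard card_in_imset // cX leqnn andbT.
  apply/subsetP => _ /imsetP[x xX ->].
  by have := subsetP PE _ (fP x xX); rewrite inE => /and3P[].
pose Q := [set p in P | p.2 != f p.1].
have [x xX|y|g [gi gQ]] := @regular_matching Q X 1 isT.
- have le1 : 1 <= #|[set p in P | p.1 == x] :\ (x, f x)|.
    by have := outP x xX; rewrite (cardsD1 (x, f x)); case: (_ \in _);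
      [rewrite add1n ltnS | rewrite add0n => /ltnW].
  apply: leq_trans le1 _; apply/subset_leq_card/subsetP => -[u v].
  rewrite !inE /= => /and3P[ne uP /eqP ux].
  by move: ne; rewrite uP ux eqxx xpair_eqE eqxx /= => ->.
- have [yX|yX] := boolP (y \in ~: X).
    move: yX; rewrite -fX => /imsetP[x xX yE].
    have xin : (x, y) \in [set p in P | p.2 == y] by rewrite inE eqxx yE fP.
    have := inP y; rewrite (cardsD1 (x, y)) xin add1n ltnS; apply: leq_trans.
    apply/subset_leq_card/subsetP => -[u v]; rewrite !inE /= => /andP[/andP[uP vf] /eqP vy].
    rewrite uP vy eqxx xpair_eqE eqxx !andbT; apply: contraNneq vf => ->.
    by rewrite vy yE.
  rewrite (_ : [set _ in _ | _] = set0) ?cards0 //; apply/setP=> -[u v]; rewrite !inE.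
  apply/negP => /andP[/andP[uP _] /eqP /= vy]; have := subsetP PE _ uP.
  by rewrite !inE /= vy -in_setC (negPf yX) andbF.
exists f, g; split=> // x xX; have := gQ x xX; rewrite inE => /andP[gP /= ne].
by split=> //; apply: (subsetP PE) => //; apply: fP.
Qed.

End TwoFactor.

(** * From two disjoint matchings to anti-directed cycles *)

Lemma perm_flatten_pairs (T : Type) (U : eqType) (a b : T -> U) (s : seq T) :
  perm_eq (flatten [seq [:: a x; b x] | x <- s]) (map a s ++ map b s).
Proof.
elim: s => //= x s IH; rewrite perm_cons.
by rewrite perm_sym -cat1s perm_catCA /= perm_cons perm_sym.
Qed.

Lemma uniq_flatten_orbits (T : finType) (h : T -> T) (s : seq T) :
  injective h -> uniq s -> {in s, forall x, froot h x = x} ->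
  uniq (flatten [seq orbit h x | x <- s]).
Proof.
move=> hi; elim: s => //= x s IH /andP[xs us] roots.
rewrite cat_uniq orbit_uniq IH //= ?andbT; last by move=> z zs; rewrite roots ?inE ?zs ?orbT.
apply/hasPn => y /flatten_mapP[z zs]; rewrite -!fconnect_orbit => zy; apply/negP => xy.
have sym := fconnect_sym hi.
have /(fingraph.rootP sym) : fconnect h x z by apply: connect_trans xy _; rewrite sym.
by rewrite !roots ?inE ?eqxx ?zs ?orbT // => xz; rewrite xz zs in xs.
Qed.

(* In the application f and g are disjoint perfect matchings from X to its
   complement, and h is the permutation g^-1 f of X: the cycle through x
   alternates between the orbit of x under h and its image under f. *)
Section Cycles.
Variables (D : digraph) (X : {set D}) (f h : D -> D).
Hypothesis f_inj : {in X &, injective f}.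
Hypothesis h_inj : injective h.
Hypothesis f_out : {in X, forall x, f x \in ~: X}.
Hypothesis h_in : {in X, forall x, [/\ h x \in X, h x != x, Defs.arc x (f x) & Defs.arc (h x) (f x)]}.

Definition alternating_cycle (x : D) : seq D * seq (D * D) :=
  (flatten [seq [:: z; f z] | z <- orbit h x],
   flatten [seq [:: (z, f z); (h z, f z)] | z <- orbit h x]).

Lemma orbit_sub x : x \in X -> {subset orbit h x <= X}.
Proof.
move=> xX y; rewrite -fconnect_orbit => /iter_findex <-.
by elim: (findex _ _ _) => //= n /h_in[].
Qed.

(** The closing vertex [z] is left free so that the induction runs along an open path; for an orbit
    it is the first vertex, and the second list becomes the rotation by one. *)
Lemma joins_alternating x p z : fpath h x p -> h (last x p) = z ->
  all2 (fun uv e => @joins D uv.1 uv.2 e)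
    (zip (flatten [seq [:: y; f y] | y <- x :: p])
         (rcons (behead (flatten [seq [:: y; f y] | y <- x :: p])) z))
    (flatten [seq [:: (y, f y); (h y, f y)] | y <- x :: p]).
Proof.
elim: p x => [|y p IH] x /=.
  by move=> _ ->; rewrite /joins !eqxx orbT.
case/andP=> /eqP xy yp lst; rewrite xy.
have j1 u v : @joins D u v (u, v) by rewrite /joins eqxx.
have j2 u v : @joins D u v (v, u) by rewrite /joins eqxx orbT.
by rewrite j1 j2; apply: IH.
Qed.

(** All arcs go from [X] to its complement, so no two of them form a directed path. The arcs
    [(z, f z)] and [(h z, f z)] are distinct because [h] has no fixed point in [X]. *)
Lemma alternating_cycleP x : x \in X -> antidirected_cycle (alternating_cycle x).
Proof.
move=> xX; have oX := orbit_sub xX.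
have uo := orbit_uniq h x.
have esP e : e \in (alternating_cycle x).2 -> [/\ e.1 \in X, e.2 \in ~: X & Defs.arc e.1 e.2].
  case/flatten_mapP => z /oX zX; have [hz _ a1 a2] := h_in zX.
  by rewrite !inE => /orP[] /eqP-> /=; rewrite ?zX ?hz ?a1 ?a2; have := f_out zX; rewrite inE.
rewrite /antidirected_cycle; apply/andP; split; last first.
  rewrite all2E size_rot eqxx /=; apply/allP => -[e1 e2] /= ez.
  have e1in : e1 \in (alternating_cycle x).2.
    by have := map_f fst ez; rewrite -/unzip1 unzip1_zip ?size_rot.
  have e2in : e2 \in (alternating_cycle x).2.
    by have := map_f snd ez; rewrite -/unzip2 unzip2_zip ?size_rot // mem_rot.
  have [a1 a2 _] := esP _ e1in; have [b1 b2 _] := esP _ e2in; rewrite !inE in a2 b2.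
  rewrite /directed_path2 negb_or; apply/andP; split; apply/eqP => E.
    by rewrite E b1 in a2.
  by rewrite E a1 in b2.
apply/and5P; split.
- rewrite (perm_size (perm_flatten_pairs id f _)) size_cat !size_map.
  by rewrite size_orbit; have := order_gt0 h x; lia.
- rewrite (perm_uniq (perm_flatten_pairs id f _)) cat_uniq map_id uo map_inj_in_uniq ?uo ?andbT.
    apply/hasPn => _ /mapP[z /oX zX ->]; apply/negP => /oX.
    by have := f_out zX; rewrite inE => /negPf->.
  by move=> y z /oX yX /oX zX; apply: f_inj.
- rewrite (perm_uniq (perm_flatten_pairs _ _ _)) cat_uniq.
  rewrite !map_inj_in_uniq ?uo ?andbT /=.
  + apply/hasPn => _ /mapP[z zo ->]; apply/negP => /mapP[y yo [hzy fzy]].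
    have zX := oX _ zo; have yX := oX _ yo; have [_ + _ _] := h_in zX.
    by rewrite hzy (f_inj zX yX fzy) eqxx.
  + by move=> y z _ _ [/h_inj].
  + by move=> y z _ _ [].
- by apply/allP => e /esP[].
- have := cycle_orbit h_inj x; rewrite /alternating_cycle; case: (orbit h x) => //= z p.
  rewrite rcons_path => /andP[zp /eqP lst].
  by rewrite cats1; have := joins_alternating zp lst.
Qed.

Lemma alternating_2factor : [set f x | x in X] = ~: X ->
  exists cs : seq (seq D * seq (D * D)), antidirected_2factor cs.
Proof.
move=> fX; pose reps := [seq x <- enum X | froot h x == x].
pose O := flatten [seq orbit h x | x <- reps].
have repsX x : x \in reps -> x \in X by rewrite mem_filter mem_enum => /andP[].
have OX : O =i X.
  move=> y; apply/flatten_mapP/idP => [[x /repsX xX]|yX]; first exact: orbit_sub.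
  have sym := fconnect_sym h_inj.
  exists (froot h y); last by rewrite -fconnect_orbit sym connect_root.
  rewrite mem_filter mem_enum (root_root sym) eqxx /=.
  by apply: (orbit_sub yX); rewrite -fconnect_orbit connect_root.
have uO : uniq O.
  apply: uniq_flatten_orbits => //; first by rewrite filter_uniq ?enum_uniq.
  by move=> x; rewrite mem_filter => /andP[/eqP].
have perm : perm_eq (flatten [seq c.1 | c <- map alternating_cycle reps]) (O ++ map f O).
  rewrite -map_comp (_ : flatten _ = flatten [seq [:: z; f z] | z <- O]).
    by rewrite (permPl (perm_flatten_pairs _ _ _)) map_id.
  by rewrite /O; elim: (reps) => //= x s ->; rewrite map_cat flatten_cat.
exists (map alternating_cycle reps); apply/and3P; split.
- by apply/allP => _ /mapP[x /repsX xX ->]; apply: alternating_cycleP.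
- rewrite (perm_uniq perm) cat_uniq uO map_inj_in_uniq ?uO ?andbT /=.
    apply/hasPn => _ /mapP[z + ->]; rewrite !OX => /f_out; by rewrite inE.
  by move=> y z; rewrite !OX; apply: f_inj.
- apply/forallP => v; rewrite (perm_mem perm) mem_cat OX.
  have [//|vX] := boolP (v \in X).
  have : v \in ~: X by rewrite inE.
  rewrite -fX => /imsetP[x xX ->]; apply/orP; right; apply: map_f.
  by rewrite OX.
Qed.

End Cycles.

Lemma antidirected_2factor_of_partition (D : digraph) (X : {set D}) : #|X| = #|~: X| ->
  (forall S T : {set D}, S \subset X -> T \subset ~: X ->
     2 * (#|S| + #|T|) <= #|arcs (@Defs.arc D) S T| + 2 * #|~: X|) ->
  exists cs : seq (seq D * seq (D * D)), antidirected_2factor cs.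
Proof.
move=> cX /(two_disjoint_matchings cX)[f [g [fi gi fgP]]].
have onto k : {in X &, injective k} -> {in X, forall x, k x \in ~: X} -> [set k x | x in X] = ~: X.
  move=> ki kX; apply/eqP; rewrite eqEcard card_in_imset // cX leqnn andbT.
  by apply/subsetP => _ /imsetP[x xX ->]; apply: kX.
have fo : {in X, forall x, f x \in ~: X}.
  by move=> x /fgP[]; rewrite inE => /and3P[].
have go : {in X, forall x, g x \in ~: X}.
  by move=> x /fgP[_]; rewrite inE => /and3P[].
(* The permutation [g^-1 f] of [X], extended by the identity so as to be injective on all
   vertices. *)
pose h x := if x \in X then odflt x [pick z in X | g z == f x] else x.
have hP x : x \in X -> h x \in X /\ g (h x) = f x.
  move=> xX; rewrite /h xX; case: pickP => [z /andP[zX /eqP]|/=] //.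
  have := fo x xX; rewrite -(onto g) // => /imsetP[z zX ->] /(_ z).
  by rewrite zX eqxx.
apply: (@alternating_2factor D X f h) => //; last exact: onto.
- move=> x y; have [xX|xX] := boolP (x \in X); have [yX|yX] := boolP (y \in X).
  + move=> E; have [_ gx] := hP x xX; have [_ gy] := hP y yX.
    by apply: fi => //; rewrite -gx -gy E.
  + by rewrite {2}/h (negPf yX) => E; case/negP: yX; rewrite -E; case: (hP x).
  + by rewrite {1}/h (negPf xX) => E; case/negP: xX; rewrite E; case: (hP y).
  + by rewrite /h (negPf xX) (negPf yX).
- move=> x xX; have [hX ghx] := hP x xX; have [fa _ _] := fgP x xX; have [_ ga neq] := fgP _ hX.
  split=> //.
  + by apply: contraNneq neq => hx; rewrite ghx hx.
  + by move: fa; rewrite inE => /and3P[].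
  + by move: ga; rewrite inE ghx => /and3P[].
Qed.

(** * Obstructions and their weight *)

Definition antitone (phi : nat -> nat) := forall i j, i <= j -> phi j <= phi i.

(* Lower bound for the weight of one side S of a minimal obstruction (S,T), where
   k = m - |T| and |S| = k + r: all vertices of S have degree at most k + 1, and
   all but 2r - 1 of them have degree at most k. *)
Definition side_weight (phi : nat -> nat) (k r : nat) : nat :=
  (k + 1 - r) * phi k + minn (k + r) (2 * r - 1) * phi k.+1.

Section Obstruction.
Variable V : finType.
Implicit Types (e : rel V) (S T X Y : {set V}).

Definition degree_into e T x := #|[set y in T | e x y]|.

Definition converse e : rel V := fun x y => e y x.

Lemma card_arcs e S T : #|arcs e S T| = \sum_(x in S) degree_into e T x.
Proof.
transitivity (\sum_(x in S) #|[set p in arcs e S T | p.1 == x]|).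
  by rewrite card_fibers; apply: eq_card => p; rewrite !inE; case: (p.1 \in S); rewrite ?andbF ?andbT.
apply: eq_bigr => x xS; rewrite /degree_into -[RHS](card_imset _ (f := fun y : V => (x, y)));
  last by move=> y z [].
apply: eq_card => -[u v]; rewrite !inE /=; apply/idP/imsetP.
  by case/andP=> /and3P[uS vT euv] /eqP ux; exists v; rewrite ?inE ?vT -?ux.
by case=> y; rewrite inE => /andP[yT exy] [-> ->]; rewrite xS yT exy eqxx.
Qed.

Lemma card_arcs_converse e S T : #|arcs (converse e) T S| = #|arcs e S T|.
Proof.
rewrite -[RHS](card_imset _ (f := fun p : V * V => (p.2, p.1))); last first.
  by move=> [a b] [c d] [-> ->].
apply: eq_card => -[u v]; rewrite inE; apply/idP/imsetP => /=.
  by case/and3P => uS vT euv; exists (v, u); rewrite ?inE //= vT uS.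
by case=> -[a b]; rewrite inE /= => /and3P[aT bS ab] [-> ->]; rewrite bS aT.
Qed.

Lemma card_arcs_converse_sum e S T : #|arcs e S T| = \sum_(y in T) degree_into (converse e) S y.
Proof. by rewrite -card_arcs_converse card_arcs. Qed.

(** Deleting a vertex with at least two arcs to the other set lowers the left side by at least 2 and
    the right side by exactly 2, so the violation persists. *)
Lemma minimal_violation e X Y m S T :
  S \subset X -> T \subset Y -> #|arcs e S T| + 2 * m < 2 * (#|S| + #|T|) ->
  exists S' T', [/\ S' \subset X /\ T' \subset Y,
    #|arcs e S' T'| + 2 * m < 2 * (#|S'| + #|T'|),
    {in S', forall x, degree_into e T' x <= 1} &
    {in T', forall y, degree_into (converse e) S' y <= 1}].
Proof.
have [n] := ubnP (#|S| + #|T|); elim: n S T => // n IH S T leST SX TY viol.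
have [/forall_inP dS|] := boolP [forall x in S, degree_into e T x <= 1]; last first.
  rewrite negb_forall_in => /exists_inP[x xS]; rewrite -ltnNge => dx.
  have := cardsD1 x S; rewrite xS => cS; move: viol.
  rewrite card_arcs (bigD1 x) //= (eq_bigl (mem (S :\ x))) -?card_arcs => [viol|y]; last first.
    by rewrite !inE andbC.
  apply: (IH (S :\ x) T) => //; rewrite ?cS in leST viol; [lia| |lia].
  exact: subset_trans (subsetDl _ _) SX.
have [/forall_inP dT|] := boolP [forall y in T, degree_into (converse e) S y <= 1]; last first.
  rewrite negb_forall_in => /exists_inP[y yT]; rewrite -ltnNge => dy.
  have := cardsD1 y T; rewrite yT => cT; move: viol.
  rewrite card_arcs_converse_sum (bigD1 y) //= (eq_bigl (mem (T :\ y))) -?card_arcs_converse_sum => [viol|z]; last first.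
    by rewrite !inE andbC.
  apply: (IH S (T :\ y)) => //; rewrite ?cT in leST viol; [lia| |lia].
  exact: subset_trans (subsetDl _ _) TY.
by exists S, T; split.
Qed.

(** A vertex of [S] has at most [#|Y| - #|T|] neighbours in [Y] outside [T]. Fewer than [2 * r]
    vertices of [S] have an arc into [T], since each of them uses one of the arcs from [S] to
    [T]. *)
Lemma side_weight_le e S T Y phi r : antitone phi -> T \subset Y ->
  #|S| + #|T| = #|Y| + r -> #|arcs e S T| < 2 * r ->
  {in S, forall x, degree_into e T x <= 1} ->
  side_weight phi (#|Y| - #|T|) r <= \sum_(x in S) phi (degree_into e Y x).
Proof.
move=> anti TY ST arcs_lt dS; set k := #|Y| - #|T|.
have deg x : degree_into e Y x <= k + degree_into e T x.
  have -> : k = #|Y :\: T| by rewrite cardsD (setIidPr TY).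
  apply: leq_trans (leq_card_setU _ _); apply/subset_leq_card/subsetP => y.
  by rewrite !inE => /andP[-> ->]; rewrite !andbT orNb.
pose S0 := [set x in S | degree_into e T x == 0].
pose S1 := S :\: S0.
have S0S : S0 \subset S by apply/subsetP=> x; rewrite inE => /andP[].
have leS1 : #|S1| < 2 * r.
  apply: leq_trans arcs_lt; rewrite ltnS card_arcs (big_setID S0) /= -sum1_card.
  apply: leq_trans (leq_addl _ _); apply: leq_sum => x; rewrite !inE negb_and => /andP[+ xS].
  by rewrite xS /= lt0n.
have cS : #|S0| + #|S1| = #|S| by rewrite -(cardsID S0 S) (setIidPr S0S).
apply: (@leq_trans (#|S0| * phi k + #|S1| * phi k.+1)).
  have := anti k k.+1 (leqnSn k); have := subset_leq_card TY.
  rewrite /side_weight; have : #|S| = k + r by rewrite /k; have := subset_leq_card TY; lia.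
  by move: #|S0| #|S1| cS leS1 (phi k) (phi k.+1) => a b <- le1 p q E _ qp; nia.
rewrite [X in _ <= X](big_setID S0) /= (setIidPr S0S) -!sum_nat_const; apply: leq_add.
  apply: leq_sum => x; rewrite inE => /andP[_ /eqP d0]; apply: anti.
  by rewrite -[k]addn0 -d0.
apply: leq_sum => x; rewrite inE => /andP[_ xS]; apply: anti.
by apply: leq_trans (deg x) _; rewrite -[k.+1]addn1 leq_add2l dS.
Qed.

Definition potential e phi X : nat :=
  \sum_(x in X) phi (degree_into e (~: X) x) +
  \sum_(y in ~: X) phi (degree_into (converse e) X y).

(** The sets [S'] and [T'] appear in the conclusion, besides the weight bound, because the
    exceptional orders exploit the structure of the obstruction itself. *)
Lemma obstruction_potential e phi X S T m : antitone phi ->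
  #|X| = m -> #|~: X| = m -> S \subset X -> T \subset ~: X ->
  #|arcs e S T| + 2 * m < 2 * (#|S| + #|T|) ->
  exists k l r S' T', [/\ [/\ k + l + r = m, 0 < r, k + r = #|S'| & l + r = #|T'|],
    S' \subset X /\ T' \subset ~: X, #|arcs e S' T'| < 2 * r &
    side_weight phi k r + side_weight phi l r <= potential e phi X].
Proof.
move=> anti cX cY SX TX /(minimal_violation SX TX)[S' [T' [[SX' TX'] viol dS dT]]].
have leS := subset_leq_card SX'; have leT := subset_leq_card TX'.
pose r := #|S'| + #|T'| - m.
exists (m - #|T'|), (m - #|S'|), r, S', T'; split; rewrite ?cX ?cY /r in leS leT *; [split; lia|by []|lia|].
apply: leq_add.
  rewrite -{1}cY; apply: leq_trans (side_weight_le (e := e) (S := S') _ _ _ _ _) _ => //; try lia.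
  by rewrite [X in _ <= X](big_setID S') /= (setIidPr SX'); exact: leq_addr.
rewrite -{1}cX; apply: leq_trans (side_weight_le (e := converse e) (S := T') _ _ _ _ _) _ => //; try lia.
  by rewrite card_arcs_converse; lia.
by rewrite [X in _ <= X](big_setID T') /= (setIidPr TX'); exact: leq_addr.
Qed.

End Obstruction.

Lemma side_weight_coarse phi k r : antitone phi -> 0 < r ->
  (k + r) * phi k.+1 <= side_weight phi k r.
Proof.
move=> anti r0; have := anti k k.+1 (leqnSn k); rewrite /side_weight.
have -> : minn (k + r) (2 * r - 1) = k + r - (k + 1 - r) by lia.
have : k + 1 - r <= k + r by lia.
by move: (k + 1 - r) (k + r) (phi k) (phi k.+1) => a b p q; nia.
Qed.

(** By symmetry [k <= l]. For [r = 1] the smaller side alone suffices by [step], unless [k = l]. For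
    [r >= 2] the coarse bound reduces to [step] at [k.+1]; what remains is [m = 2k+3] and
    [m = 2k+2], where both sides are needed. *)
Lemma side_weight_total phi W m : antitone phi ->
  (forall k, k.*2.+1 < m -> W <= k * phi k + phi k.+1) ->
  (forall c, m = c.*2.+1 -> W <= 2 * (c * phi c)) ->
  (forall c, m = c.*2.+2 -> (W <= 2 * ((c + 2) * phi c.+1)) || (W <= 2 * (c.-1 * phi c))) ->
  forall k l r, k + l + r = m -> 0 < r -> W <= side_weight phi k r + side_weight phi l r.
Proof.
move=> anti step odd_top even_top.
suff wlog_le k l r : k <= l -> k + l + r = m -> 0 < r -> W <= side_weight phi k r + side_weight phi l r.
  by move=> k l r; case/orP: (leq_total k l) => kl E r0; [|rewrite addnC]; apply: wlog_le; lia.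
move=> kl E r0; have coarse j := @side_weight_coarse phi j r anti r0.
have [r1|r1] := eqVneq r 1.
  have side1 j : side_weight phi j 1 = j * phi j + phi j.+1.
    by rewrite /side_weight addnK addn1 minnSS minn0 mul1n.
  rewrite r1 in E *; rewrite !side1; have [kl'|kl'] := eqVneq k l.
    by have := odd_top k; rewrite -kl'; lia.
  by have := step k; lia.
have r2 : 2 <= r by lia.
have [lt|ge] := ltnP (k.+1).*2.+1 m.
  apply: leq_trans (leq_addr _ _); apply: leq_trans (coarse k).
  have := step _ lt; have := anti k.+1 k.+2 (leqnSn _); move: (phi k.+1) (phi k.+2) => p q.
  by move=> qp /leq_trans; apply; nia.
have [modd|meven] := eqVneq m (k.+1).*2.+1.
  have := odd_top _ modd; move/leq_trans; apply.
  have [r2'|r3] := eqVneq r 2.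
    have lk : l = k.+1 by lia.
    have := coarse k; rewrite r2' lk; move/leq_add => /(_ (k * phi k.+1) (side_weight phi k.+1 2)).
    have -> : k * phi k.+1 <= side_weight phi k.+1 2.
      by rewrite /side_weight (_ : k.+1 + 1 - 2 = k) ?leq_addr //; lia.
    by move/(_ isT); apply: leq_trans; nia.
  have lk : l = k by lia.
  have := leq_add (coarse k) (coarse l); rewrite lk; apply: leq_trans.
  by move: (phi k.+1) => p; nia.
have mE : m = k.*2.+2 by lia.
have lk : l = k by lia.
have r2' : r = 2 by lia.
have := leq_add (coarse k) (coarse l); rewrite lk r2'.
case/orP: (even_top _ mE) => /leq_trans H.
  by move=> le; apply: H; apply: leq_trans le; lia.
move=> _; apply: H; rewrite mul2n -addnn leq_add //;
  rewrite /side_weight (_ : k + 1 - 2 = k.-1) ?leq_addr //; lia.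
Qed.

(** * Averaging over balanced partitions *)

(* The sum of g(|Y :&: N|) over the y-subsets Y of an a-set with an n-subset N. *)
Definition draw_sum (a n y : nat) (g : nat -> nat) : nat :=
  \sum_(j < y.+1) 'C(n, j) * 'C(a - n, y - j) * g j.

Lemma eq_draw_sum a n y g g' : g =1 g' -> draw_sum a n y g = draw_sum a n y g'.
Proof. by move=> gg; apply: eq_bigr => j _; rewrite gg. Qed.

Section Draws.
Variable V : finType.
Implicit Types (A N Y : {set V}).

Definition draws A y : {set {set V}} := [set Y : {set V} | Y \subset A & #|Y| == y].

Lemma card_draws_meet A N y j : j <= y ->
  #|[set Y in draws A y | #|Y :&: N| == j]| = 'C(#|A :&: N|, j) * 'C(#|A :\: N|, y - j).
Proof.
move=> jy; rewrite -!cards_draws -cardsX.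
rewrite -(card_in_imset (f := fun Y : {set V} => (Y :&: N, Y :\: N))); last first.
  by move=> Y Z _ _ [eI eD]; rewrite -(setID Y N) eI eD setID.
apply: eq_card => -[P Q]; rewrite !inE /=; apply/imsetP/idP.
  case=> Y; rewrite !inE => /andP[/andP[YA /eqP cY] /eqP cI] [-> ->].
  rewrite setSI // setSD // cI eqxx /= -cI -cY -(cardsID N Y) addKn eqxx //.
case/andP=> /andP[PAN /eqP cP] /andP[QAN /eqP cQ].
have PN : P :&: N = P by apply/setIidPl/(subset_trans PAN)/subsetIr.
have QN : Q :&: N = set0.
  apply/setP=> z; rewrite !inE; case: (boolP (z \in Q)) => //= /(subsetP QAN).
  by rewrite inE => /andP[/negPf].
have PDN : P :\: N = set0 by apply/eqP; rewrite setD_eq0 (subset_trans PAN) ?subsetIr.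
have QDN : Q :\: N = Q by apply/setDidPl; rewrite -setI_eq0 QN.
exists (P :|: Q); last by rewrite setIUl setDUl PN QN PDN QDN setU0 set0U.
rewrite !inE setIUl PN QN setU0 cP eqxx andbT subUset.
rewrite (subset_trans PAN (subsetIl _ _)) (subset_trans QAN (subsetDl _ _)) /=.
rewrite cardsU (_ : P :&: Q = set0) ?cards0 ?cP ?cQ ?subn0 ?subnKC //.
by rewrite -PN -setIA [N :&: Q]setIC QN setI0.
Qed.

Lemma sum_draws A N y (g : nat -> nat) :
  \sum_(Y in draws A y) g #|Y :&: N| = draw_sum #|A| #|A :&: N| y g.
Proof.
have lt Y : Y \in draws A y -> #|Y :&: N| < y.+1.
  by rewrite inE ltnS => /andP[_ /eqP <-]; rewrite subset_leq_card ?subsetIl.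
rewrite (partition_big (fun Y => inord #|Y :&: N| : 'I_y.+1) predT) //=.
apply: eq_bigr => j _; rewrite -cardsD -card_draws_meet -1?ltnS //.
rewrite -sum1_card big_distrl /=; apply: eq_big => [Y|Y /andP[/lt YA /eqP <-]].
  rewrite [in RHS]inE; case: (boolP (Y \in draws A y)) => //= /lt YA.
  by rewrite -val_eqE /= inordK.
by rewrite mul1n inordK.
Qed.

(** Halves of [A] are exchanged by complementation; this lets the sink part of the potential be
    treated as the source part for the converse relation. *)
Lemma sum_draws_compl A y (F : {set V} -> nat) : #|A| = y.*2 ->
  \sum_(Y in draws A y) F Y = \sum_(Y in draws A y) F (A :\: Y).
Proof.
move=> cA; have inv Y : Y \in draws A y -> A :\: Y \in draws A y /\ A :\: (A :\: Y) = Y.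
  rewrite inE => /andP[YA /eqP cY]; rewrite inE subsetDl cardsD (setIidPr YA) cA cY.
  by split; [apply/eqP; lia | rewrite setDDr setDv set0U (setIidPr YA)].
rewrite (reindex_onto (fun Y => A :\: Y) (fun Y => A :\: Y)) => [|Y /inv[]//].
apply: eq_bigl => Y; apply/andP/idP => [[/inv[h1 h2] /eqP <-]|/inv[-> ->]] //.
Qed.

End Draws.

Definition strata_sum (a n y : nat * nat * nat) (phi : nat -> nat) : nat :=
  draw_sum a.1.1 n.1.1 y.1.1 (fun i => draw_sum a.1.2 n.1.2 y.1.2 (fun j =>
    draw_sum a.2 n.2 y.2 (fun k => phi (i + j + k)))).

(* Averages over the sets that contain exactly half of each of the three sets A,
   B, C; the uniform distribution is the case where B and C are empty. *)
Section Strata.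
Variables (V : finType) (A B C : {set V}) (a b c : nat).
Hypotheses (cA : #|A| = a.*2) (cB : #|B| = b.*2) (cC : #|C| = c.*2).
Hypothesis part : forall v, (v \in A) + (v \in B) + (v \in C) = 1.
Variable phi : nat -> nat.
Hypothesis anti : antitone phi.
Implicit Types (e : rel V) (P Q R N : {set V}).

Lemma draws_avoid P y v (F : {set V} -> nat) : (forall Q, v \in Q -> F Q = 0) ->
  \sum_(Q in draws P y) F Q = \sum_(Q in draws (P :\ v) y) F Q.
Proof.
move=> F0; rewrite [LHS](bigID (fun Q => v \in Q)) /= big1 => [|Q /andP[_ /F0]//].
by rewrite add0n; apply: eq_bigl => Q; rewrite !inE subsetD1 -!andbA; congr (_ && _); rewrite andbC.
Qed.

(** The drawn set is the side opposite to [v], so the draws come from the strata with [v]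
    removed. *)
Definition vertex_sum v N := strata_sum
  (#|A :\ v|, #|B :\ v|, #|C :\ v|)
  (#|(A :\ v) :&: N|, #|(B :\ v) :&: N|, #|(C :\ v) :&: N|) (a, b, c) phi.

Lemma card_meet_union P Q R N : P \subset A -> Q \subset B -> R \subset C ->
  #|(P :|: Q :|: R) :&: N| = #|P :&: N| + #|Q :&: N| + #|R :&: N|.
Proof.
move=> PA QB RC; rewrite -!sum1_card [LHS]big_mkcond [X in _ = X + _ + _]big_mkcond.
rewrite [X in _ = _ + X + _]big_mkcond [X in _ = _ + _ + X]big_mkcond -!big_split /=.
apply: eq_bigr => v _; rewrite !inE.
have := part v; have /implyP := subsetP PA v; have /implyP := subsetP QB v.
have /implyP := subsetP RC v.
by do 7?case: (v \in _).
Qed.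

Lemma vertex_sum_ge e v N : N \subset [set w | e v w] ->
  \sum_(P in draws A a) \sum_(Q in draws B b) \sum_(R in draws C c)
    (if v \in ~: (P :|: Q :|: R) then phi (degree_into e (P :|: Q :|: R) v) else 0)
  <= vertex_sum v N.
Proof.
move=> Ne; rewrite (@draws_avoid A a v); last first.
  by move=> P vP; rewrite big1 // => Q _; rewrite big1 // => R _; rewrite !inE vP.
rewrite /vertex_sum /strata_sum /= -sum_draws; apply: leq_sum => P PA.
rewrite (@draws_avoid B b v); last first.
  by move=> Q vQ; rewrite big1 // => R _; rewrite !inE vQ orbT.
rewrite -sum_draws; apply: leq_sum => Q QB.
rewrite (@draws_avoid C c v); last by move=> R vR; rewrite !inE vR orbT.
rewrite -(sum_draws _ _ _ (fun k => phi (_ + k))); apply: leq_sum => R RC.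
case: ifP => // _; apply: anti.
move: PA QB RC; rewrite !inE !subsetD1 => /andP[/andP[PA _] _] /andP[/andP[QB _] _] /andP[/andP[RC _] _].
rewrite -card_meet_union //; apply/subset_leq_card/subsetP => w; rewrite !inE => /andP[-> /(subsetP Ne)].
by rewrite inE.
Qed.

Lemma compl_union P Q R : P \subset A -> Q \subset B -> R \subset C ->
  (A :\: P) :|: (B :\: Q) :|: (C :\: R) = ~: (P :|: Q :|: R).
Proof.
move=> PA QB RC; apply/setP=> v; rewrite !inE.
have := part v; have /implyP := subsetP PA v; have /implyP := subsetP QB v.
have /implyP := subsetP RC v.
by do 7?case: (v \in _).
Qed.

Lemma sum_potential_le e (Nout Nin : V -> {set V}) :
  (forall v, Nout v \subset [set w | e v w]) ->
  (forall v, Nin v \subset [set w | e w v]) ->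
  \sum_(P in draws A a) \sum_(Q in draws B b) \sum_(R in draws C c)
    potential e phi (~: (P :|: Q :|: R))
  <= \sum_v vertex_sum v (Nout v) + \sum_v vertex_sum v (Nin v).
Proof.
move=> outN inN.
pose out e' := \sum_(P in draws A a) \sum_(Q in draws B b) \sum_(R in draws C c)
  \sum_(x in ~: (P :|: Q :|: R)) phi (degree_into e' (P :|: Q :|: R) x).
have out_le e' (M : V -> {set V}) : (forall v, M v \subset [set w | e' v w]) ->
    out e' <= \sum_v vertex_sum v (M v).
  move=> NP; apply: leq_trans (leq_sum _ (fun v _ => vertex_sum_ge (NP v))).
  rewrite [leqRHS]exchange_big; apply: leq_sum => P _; rewrite [leqRHS]exchange_big; apply: leq_sum => Q _.
  by rewrite [leqRHS]exchange_big; apply: leq_sum => R _; rewrite big_mkcond.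
apply: leq_trans (leq_add (out_le e Nout outN) (out_le (converse e) Nin inN)).
rewrite {1}/out /potential.
under eq_bigr do (under eq_bigr do rewrite big_split; rewrite big_split).
rewrite big_split /=; apply: leq_add.
  by apply: leq_sum => P _; apply: leq_sum => Q _; apply: leq_sum => R _; rewrite setCK.
rewrite [leqLHS](sum_draws_compl _ cA); apply: leq_sum => P; rewrite inE => /andP[PA _].
rewrite [leqLHS](sum_draws_compl _ cB); apply: leq_sum => Q; rewrite inE => /andP[QB _].
rewrite [leqLHS](sum_draws_compl _ cC); apply: leq_sum => R; rewrite inE => /andP[RC _].
by rewrite setCK compl_union // setCK.
Qed.

Lemma strata_average W e (Nout Nin : V -> {set V}) :
  (forall v, Nout v \subset [set w | e v w]) ->
  (forall v, Nin v \subset [set w | e w v]) ->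
  (forall X : {set V}, #|X| = #|~: X| -> W <= potential e phi X) ->
  W * ('C(a.*2, a) * 'C(b.*2, b) * 'C(c.*2, c)) <=
    \sum_v vertex_sum v (Nout v) + \sum_v vertex_sum v (Nin v).
Proof.
move=> outN inN lower; apply: leq_trans (sum_potential_le outN inN).
apply: (@leq_trans (\sum_(P in draws A a) \sum_(Q in draws B b) \sum_(R in draws C c) W)).
  by rewrite !sum_nat_const !cards_draws cA cB cC; lia.
apply: leq_sum => P; rewrite inE => /andP[PA /eqP cP].
apply: leq_sum => Q; rewrite inE => /andP[QB /eqP cQ].
apply: leq_sum => R; rewrite inE => /andP[RC /eqP cR].
have cU (S1 S2 S3 : {set V}) : S1 \subset A -> S2 \subset B -> S3 \subset C ->
    #|S1 :|: S2 :|: S3| = #|S1| + #|S2| + #|S3|.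
  by move=> h1 h2 h3; have := card_meet_union setT h1 h2 h3; rewrite !setIT.
apply: lower; rewrite setCK -compl_union // !cU ?subsetDl //.
by rewrite !cardsD (setIidPr PA) (setIidPr QB) (setIidPr RC); lia.
Qed.

End Strata.

Lemma draw_sum0 g : draw_sum 0 0 0 g = g 0.
Proof. by rewrite /draw_sum big_ord1 /= !bin0 !mul1n. Qed.

(** Since the weights are antitone, cutting each neighbourhood down to exactly [d] vertices still
    yields an upper bound for the average, and one that depends on [d] instead of the true
    degree. *)
Definition trim (V : finType) (d : nat) (S : {set V}) : {set V} := [set x in take d (enum S)].

Lemma trim_sub (V : finType) d (S : {set V}) : trim d S \subset S.
Proof. by apply/subsetP => x; rewrite inE => /mem_take; rewrite mem_enum. Qed.

Lemma mem_trim (V : finType) d (S : {set V}) x : x \in trim d S -> x \in S.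
Proof. exact: (subsetP (trim_sub d S)). Qed.

Lemma card_trim (V : finType) d (S : {set V}) : d <= #|S| -> #|trim d S| = d.
Proof.
move=> dS; rewrite cardsE (card_uniqP _) ?take_uniq ?enum_uniq //.
by rewrite size_takel // -cardE.
Qed.

Lemma uniform_average (V : finType) (e : rel V) m d phi W : irreflexive e ->
  #|V| = m.+1.*2 -> antitone phi ->
  (forall v, d <= #|[set w | e v w]|) -> (forall v, d <= #|[set w | e w v]|) ->
  (forall X : {set V}, #|X| = #|~: X| -> W <= potential e phi X) ->
  W * 'C(m.*2.+1, m.+1) <= m.+1.*2 * draw_sum m.*2.+1 d m.+1 phi.
Proof.
move=> irr cV anti dout din lower.
have part v : (v \in [set: V]) + (v \in set0) + (v \in set0) = 1 by rewrite !inE.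
have := @strata_average V setT set0 set0 m.+1 0 0 _ (cards0 V) (cards0 V) part phi anti W e
  (fun v => trim d [set w | e v w]) (fun v => trim d [set w | e w v]).
rewrite cardsT cV !bin0 !muln1 => /(_ erefl).
have vs v (S : {set V}) : v \notin S -> d <= #|S| ->
    vertex_sum setT set0 set0 m.+1 0 0 phi v (trim d S) = draw_sum m.*2.+1 d m.+1 phi.
  move=> vS dS; rewrite /vertex_sum /strata_sum /= !set0D !set0I !cards0.
  have -> : #|[set: V] :\ v| = m.*2.+1.
    by have := cardsD1 v [set: V]; rewrite inE cardsT cV; lia.
  have -> : ([set: V] :\ v) :&: trim d S = trim d S.
    apply/setIidPr/subsetP => x /(subsetP (trim_sub _ _)) xS.
    by rewrite !inE andbT; apply: contraNneq vS => <-.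
  rewrite card_trim //; apply: eq_draw_sum => i.
  by rewrite !draw_sum0 !addn0.
move=> H; have := H _ _ lower.
rewrite (eq_bigr (fun=> draw_sum m.*2.+1 d m.+1 phi)); last first.
  by move=> v _; apply: vs; rewrite ?inE ?irr.
rewrite [X in _ + X](eq_bigr (fun=> draw_sum m.*2.+1 d m.+1 phi)); last first.
  by move=> v _; apply: vs; rewrite ?inE ?irr.
rewrite !sum_nat_const cV => H2.
have /H2 : forall v, trim d [set w | e v w] \subset [set w | e v w] by move=> v; apply: trim_sub.
(* This factor 2 cancels against the two equal sums, one for out-degrees and one for in-degrees. *)
have central : 'C(m.+1.*2, m.+1) = 2 * 'C(m.*2.+1, m.+1).
  rewrite doubleS binS [in X in _ + X = _]/= -[in X in _ + X = _](bin_sub (n := m.*2.+1)); last lia.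
  by rewrite (_ : m.*2.+1 - m = m.+1); lia.
by rewrite central => H3; have := H3 (fun v => trim_sub _ _); lia.
Qed.

(* Up to the factor 'C(2m-1, m), hypergeom j is the probability that d given
   vertices contain exactly j of the m vertices of a random half of 2m - 1. *)
Section TailCriterion.
Variables m d : nat.
Hypothesis d_lt : d < m.*2.
Hypothesis m_lt : m < d.

Definition hypergeom (j : nat) : nat := 'C(d, j) * 'C(m.*2.-1 - d, m - j).

Lemma hypergeom_ratio j : j < m ->
  j.+1 * (m.*2.-1 - d + j.+1 - m) * hypergeom j.+1 = (d - j) * (m - j) * hypergeom j.
Proof.
move=> jm; rewrite /hypergeom; have -> : m - j = (m - j.+1).+1 by lia.
have -> : m.*2.-1 - d + j.+1 - m = m.*2.-1 - d - (m - j.+1) by lia.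
have := mul_bin_left d j; have := mul_bin_left (m.*2.-1 - d) (m - j.+1).
by move: (m.*2.-1 - d - (m - j.+1)) => x e1 e2; nia.
Qed.

Lemma sum_hypergeom : \sum_(j < m.+1) hypergeom j = 'C(m.*2.-1, m).
Proof. by rewrite binomial.Vandermonde subnKC //; lia. Qed.

Lemma draw_sum_hypergeom phi : draw_sum m.*2.-1 d m phi = \sum_(j < m.+1) hypergeom j * phi j.
Proof. by []. Qed.

Lemma sum_split c (F : nat -> nat) : c <= m ->
  \sum_(j < m.+1) F j = \sum_(j < c.+1) F j + \sum_(c.+1 <= j < m.+1) F j.
Proof. by move=> cm; rewrite -(big_mkord predT F) (big_cat_nat (n := c.+1)) //= big_mkord. Qed.

(** Downward induction from [c]: [u] satisfies as an inequality the recurrence that [hypergeom]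
    satisfies with equality. *)
Lemma hypergeom_upper c sc u : c <= m -> sc <= u c ->
  (forall j, j < c -> j.+1 * (m.*2.-1 - d + j.+1 - m) * u j.+1 <= (d - j) * (m - j) * u j) ->
  forall j, j <= c -> sc * hypergeom j <= u j * hypergeom c.
Proof.
move=> cm uc uj j jc.
rewrite -(subKn jc); elim: (c - j) (leq_subr j c) => [|i IH] ic.
  by rewrite subn0 leq_mul2r uc orbT.
have := IH (ltnW ic); set k := c - i.+1; have -> : c - i = k.+1 by rewrite /k; lia.
have kc : k < c by rewrite /k; lia.
have km : k < m by lia.
have pos : 0 < (d - k) * (m - k) by rewrite muln_gt0; lia.
have := hypergeom_ratio km; have := uj k kc.
move: (_ * (_ - m)) ((d - k) * (m - k)) pos => p q q0 h1 h2 h3.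
have := leq_mul (leqnn p) h3; have := leq_mul h1 (leqnn (hypergeom c)).
move=> g1 g2; rewrite -(leq_pmul2l q0).
have -> : q * (sc * hypergeom k) = p * (sc * hypergeom k.+1) by rewrite mulnCA -h2 mulnCA.
by apply: (leq_trans g2); rewrite [leqLHS]mulnA [leqRHS]mulnA.
Qed.

(** The same comparison upwards from [c]; here the factor to be cancelled is the one assumed
    positive. *)
Lemma hypergeom_lower c sc I l : c + I <= m -> l c <= sc ->
  (forall j, c <= j < c + I -> 0 < m.*2.-1 - d + j.+1 - m /\
     j.+1 * (m.*2.-1 - d + j.+1 - m) * l j.+1 <= (d - j) * (m - j) * l j) ->
  forall j, c <= j <= c + I -> l j * hypergeom c <= sc * hypergeom j.
Proof.
move=> cI lc lj j.
elim: j => [|j IH].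
  by rewrite leqn0 => /andP[/eqP<- _]; rewrite leq_mul2r lc orbT.
case/andP; rewrite leq_eqVlt => /orP[/eqP<- _|cj jI].
  by rewrite leq_mul2r lc orbT.
have jI' : c <= j < c + I by lia.
have [pos h1] := lj j jI'; have {}IH := IH ltac:(lia).
have jm : j < m by lia.
have := hypergeom_ratio jm; move: h1; have : 0 < j.+1 * (m.*2.-1 - d + j.+1 - m) by rewrite muln_gt0.
move: (_ * (_ - m)) ((d - j) * (m - j)) => p q p0 h1 h2.
have := leq_mul (leqnn q) IH; have := leq_mul h1 (leqnn (hypergeom c)).
move=> g1 g2; rewrite -(leq_pmul2l p0).
have -> : p * (sc * hypergeom j.+1) = q * (sc * hypergeom j) by rewrite mulnCA h2 mulnCA.
by apply: leq_trans g2; rewrite [leqLHS]mulnA [leqRHS]mulnA.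
Qed.

(* u j / sc bounds hypergeom j / hypergeom c from above for j <= c, and l j / sc
   bounds it from below for j >= c. *)
Lemma tail_criterion c I W sc phi u l : c + I <= m -> 0 < sc -> 0 < W ->
  (forall j, c < j -> phi j = 0) ->
  sc <= u c ->
  (forall j, j < c -> j.+1 * (m.*2.-1 - d + j.+1 - m) * u j.+1 <= (d - j) * (m - j) * u j) ->
  l c <= sc ->
  (forall j, c <= j < c + I -> 0 < m.*2.-1 - d + j.+1 - m /\
     j.+1 * (m.*2.-1 - d + j.+1 - m) * l j.+1 <= (d - j) * (m - j) * l j) ->
  \sum_(j < c.+1) (m.*2 * phi j - W) * u j < W * \sum_(c.+1 <= j < (c + I).+1) l j ->
  m.*2 * draw_sum m.*2.-1 d m phi < W * 'C(m.*2.-1, m).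
Proof.
move=> cI sc0 W0 phi0 uc uj lc lj key.
have cm : c <= m by apply: leq_trans cI; apply: leq_addr.
have upper := hypergeom_upper cm uc uj.
have lower := hypergeom_lower cI lc lj.
rewrite draw_sum_hypergeom -sum_hypergeom (sum_split _ cm) (sum_split (fun j => hypergeom j * phi j) cm).
rewrite [X in _ * (_ + X) < _]big_nat_cond [X in _ * (_ + X) < _]big1; last first.
  by move=> j; rewrite andbT => /andP[cj _]; rewrite phi0 // muln0.
rewrite addn0.
(* Truncated subtraction replaces a negative excess over [W] by 0, which is harmless in an upper
   bound. *)
have step : m.*2 * \sum_(j < c.+1) hypergeom j * phi j <=
    \sum_(j < c.+1) (m.*2 * phi j - W) * hypergeom j + W * \sum_(j < c.+1) hypergeom j.
  rewrite !big_distrr /= -big_split /=; apply: leq_sum => j _; rewrite -mulnDl.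
  by rewrite [hypergeom j * _]mulnC mulnA leq_mul2r; apply/orP; right; lia.
apply: leq_ltn_trans step _; rewrite mulnDr addnC ltn_add2l.
have mono : \sum_(c.+1 <= j < (c + I).+1) hypergeom j <= \sum_(c.+1 <= j < m.+1) hypergeom j.
  by rewrite [leqRHS](big_cat_nat (n := (c + I).+1)) ?leq_addr //=; lia.
(* If the reference term vanishes, so do all terms up to [c], and only positivity of the total mass
   remains to be checked. *)
have [hc0|hc0] := posnP (hypergeom c).
  rewrite big1 => [|j _]; last first.
    have jc : j <= c by rewrite -ltnS.
    by have := upper j jc; rewrite hc0 muln0 leqn0 muln_eq0; case: (sc) sc0 => //= ? _ /eqP->; rewrite muln0.
  rewrite muln_gt0 W0 /=.
  have : 0 < \sum_(j < m.+1) hypergeom j by rewrite sum_hypergeom bin_gt0; lia.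
  rewrite (sum_split _ cm) [X in X + _]big1 // => j _.
  have jc : j <= c by rewrite -ltnS.
  by have := upper j jc; rewrite hc0 muln0 leqn0 muln_eq0; case: (sc) sc0 => //= ? _ /eqP->.
rewrite -(ltn_pmul2l sc0).
apply: (@leq_ltn_trans ((\sum_(j < c.+1) (m.*2 * phi j - W) * u j) * hypergeom c)).
  rewrite big_distrr big_distrl /=; apply: leq_sum => j _.
  by rewrite mulnCA -mulnA leq_mul2l upper ?orbT // -ltnS.
apply: (@leq_trans (W * (\sum_(c.+1 <= j < (c + I).+1) l j) * hypergeom c)).
  by rewrite ltn_mul2r hc0.
rewrite mulnCA -mulnA leq_mul2l; apply/orP; right.
apply: leq_trans (_ : sc * \sum_(c.+1 <= j < (c + I).+1) hypergeom j <= _); last by rewrite leq_mul2l mono orbT.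
rewrite big_distrr big_distrl /= [leqLHS]big_nat_cond [leqRHS]big_nat_cond; apply: leq_sum => j.
by rewrite andbT => /andP[cj jI]; apply: lower; lia.
Qed.

End TailCriterion.

(** * Orders 5 <= m < 360 *)

(* phi_table, u_below and l_above only propose values for the functions phi, u, l of
   tail_criterion, in fixed-point arithmetic; nothing is proved about them, as
   certificate checks all the inequalities that are needed. *)
Section Certificate.
Local Open Scope N_scope.

Fixpoint adjacent (r : N -> N -> N -> bool) (k : N) (s : seq N) : bool :=
  match s with
  | x :: (y :: _) as s' => r k x y && adjacent r (k + 1) s'
  | _ => true
  end.

Definition ceil_div a b := (a + b - 1) / b.

(** Solves [W <= k * phi k + phi k.+1] downwards in [k], rounding up and keeping the table antitone.
    At [k = 0] the condition reads [W <= phi 1], whence the value [W] for [k <= 1]. *)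
Fixpoint phi_below (W : N) (fuel : nat) (k : N) (p : N) (s : seq N) : seq N :=
  if fuel is fuel'.+1 then
    let p' := if k <=? 1 then W else N.max p (ceil_div (W - p) k) in
    phi_below W fuel' (k - 1) p' (p' :: s)
  else s.

Definition phi_table (W m : N) : seq N :=
  let c := (m - 1) / 2 in
  let p := if N.odd m then ceil_div W (2 * c) else ceil_div W c in
  phi_below W (N.to_nat c) (c - 1) p [:: p].

Fixpoint u_below (m d M : N) (fuel : nat) (k u : N) (s : seq N) : seq N :=
  if fuel is fuel'.+1 then
    let u' := ceil_div ((k + 1) * (M + (k + 1) - m) * u) ((d - k) * (m - k)) in
    u_below m d M fuel' (k - 1) u' (u' :: s)
  else s.

Fixpoint l_above (m d M : N) (fuel : nat) (k l : N) : seq N :=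
  l :: (if fuel is fuel'.+1 then
    l_above m d M fuel' (k + 1) ((d - k) * (m - k) * l / ((k + 1) * (M + (k + 1) - m)))
  else [::]).

Fixpoint weighted (W m : N) (p u : seq N) : N :=
  match p, u with
  | x :: p', y :: u' => (2 * m * x - W) * y + weighted W m p' u'
  | _, _ => 0
  end.

Definition total (s : seq N) : N := foldr N.add 0 s.

(** [d] is the least integer above 25m/24 = 25n/48, and [M] counts the vertices other than a given
    vertex and [d] of its neighbours. *)
Definition certificate (W scale m : N) (phi u l : seq N) : bool :=
  let c := (m - 1) / 2 in
  let d := m + m / 24 + 1 in
  let M := 2 * m - 1 - d in
  [&& (0 <? W), (0 <? scale), (N.of_nat (size phi) =? c + 1), (N.of_nat (size u) =? c + 1),
      (c + N.of_nat (size l) <=? m + 1), (2 <=? c),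
      adjacent (fun k x y => (y <=? x) && (W <=? k * x + y)) 0 phi,
      (W <=? (if m =? 2 * c + 1 then 2 * (c * last 0 phi) else c * last 0 phi)),
      scale <=? last 0 u,
      adjacent (fun k x y => (k + 1) * (M + (k + 1) - m) * y <=? (d - k) * (m - k) * x) 0 u,
      (head 0 l <=? scale), (0 <? M + (c + 1) - m),
      adjacent (fun k x y => (k + 1) * (M + (k + 1) - m) * y <=? (d - k) * (m - k) * x) c l &
      weighted W m phi u <? W * total (behead l)].

Definition certified (m : N) : bool :=
  let c := (m - 1) / 2 in
  let d := m + m / 24 + 1 in
  let M := 2 * m - 1 - d in
  let W := 1000000 in
  let scale := 100000000 in
  certificate W scale m (phi_table W m)
    (u_below m d M (N.to_nat c) (c - 1) scale [:: scale])
    (l_above m d M (N.to_nat (N.min 25 (m - c))) c scale).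

Fixpoint range_from (k : N) (n : nat) : seq N := if n is n'.+1 then k :: range_from (k + 1) n' else [::].

End Certificate.

Lemma adjacentP r k s : adjacent r k s -> forall j, j.+1 < size s ->
  r (k + N.of_nat j)%num (nth 0%num s j) (nth 0%num s j.+1).
Proof.
elim: s k => //= x [|y s] IH k //= /andP[rxy rs] [_|j js].
  by rewrite N.add_0_r.
rewrite (_ : (k + _)%num = (k + 1 + N.of_nat j)%num); last lia.
exact: (IH (k + 1)%num rs j).
Qed.

Lemma to_nat_total s : N.to_nat (total s) = \sum_(j < size s) N.to_nat (nth 0%num s j).
Proof.
elim: s => [|x s IH]; first by rewrite big_ord0.
by rewrite big_ord_recl /= -IH N2Nat.inj_add.
Qed.

Lemma to_nat_weighted W m p u : size p = size u ->
  N.to_nat (weighted W m p u) = \sum_(j < size p)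
    ((N.to_nat m).*2 * N.to_nat (nth 0%num p j) - N.to_nat W) * N.to_nat (nth 0%num u j).
Proof.
elim: p u => [|x p IH] [|y u] //; first by rewrite big_ord0.
case=> /IH E; rewrite big_ord_recl -[in RHS]E.
rewrite [weighted _ _ _ _](_ : _ = ((2 * m * x - W) * y + weighted W m p u)%num) //.
rewrite N2Nat.inj_add N2Nat.inj_mul N2Nat.inj_sub N2Nat.inj_mul N2Nat.inj_mul.
by rewrite -mul2n.
Qed.

Definition admissible (W m : nat) (phi : nat -> nat) :=
  [/\ antitone phi, (forall k, k.*2.+1 < m -> W <= k * phi k + phi k.+1),
  (forall c, m = c.*2.+1 -> W <= 2 * (c * phi c)) &
  (forall c, m = c.*2.+2 -> (W <= 2 * ((c + 2) * phi c.+1)) || (W <= 2 * (c.-1 * phi c)))].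

Lemma ratio_leN m d M j x y :
  ((N.of_nat j + 1) * (N.of_nat M + (N.of_nat j + 1) - N.of_nat m) * y <=?
    (N.of_nat d - N.of_nat j) * (N.of_nat m - N.of_nat j) * x)%num ->
  j.+1 * (M + j.+1 - m) * N.to_nat y <= (d - j) * (m - j) * N.to_nat x.
Proof.
move/N.leb_le => H; have : N.to_nat ((N.of_nat j + 1) * (N.of_nat M + (N.of_nat j + 1) - N.of_nat m) * y)
  <= N.to_nat ((N.of_nat d - N.of_nat j) * (N.of_nat m - N.of_nat j) * x) by lia.
rewrite !N2Nat.inj_mul !N2Nat.inj_sub !N2Nat.inj_add !Nat2N.id.
by rewrite -[N.to_nat 1]/1 -!plusE !PeanoNat.Nat.add_1_r.
Qed.

Lemma certificate_sound W scale m phi u l : certificate W scale (N.of_nat m) phi u l ->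
  exists W f, admissible W m f /\
    m.*2 * draw_sum m.*2.-1 (m + m %/ 24 + 1) m f < W * 'C(m.*2.-1, m).
Proof.
move=> cert.
case/andP: cert => /N.ltb_lt W0 /andP[/N.ltb_lt sc0] /andP[/N.eqb_eq sp] /andP[/N.eqb_eq su] /andP[/N.leb_le sl] /andP[/N.leb_le c2].
case/andP=> /adjacentP adjp /andP[/N.leb_le topp] /andP[/N.leb_le topu] /andP[/adjacentP adju].
case/andP=> /N.leb_le headl /andP[/N.ltb_lt Mpos] /andP[/adjacentP adjl /N.ltb_lt key].
have [c cE] : exists c, c = (m - 1) %/ 2 by exists ((m - 1) %/ 2).
have [d dE] : exists d, d = m + m %/ 24 + 1 by exists (m + m %/ 24 + 1).
have cN : ((N.of_nat m - 1) / 2)%num = N.of_nat c.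
  by symmetry; apply: (N.div_unique _ _ _ (N.of_nat ((m - 1) %% 2))); lia.
have dN : (N.of_nat m + N.of_nat m / 24 + 1)%num = N.of_nat d.
  rewrite -(N.div_unique (N.of_nat m) 24 (N.of_nat (m %/ 24)) (N.of_nat (m %% 24))); lia.
have MN : (2 * N.of_nat m - 1 - N.of_nat d)%num = N.of_nat (m.*2.-1 - d) by lia.
rewrite ?cN ?dN ?MN in sp su sl c2 topp adju Mpos adjl.
have {}sp : size phi = c.+1 by lia.
have {}su : size u = c.+1 by lia.
have {}c2 : 2 <= c by lia.
have {}sl : c + size l <= m.+1 by lia.
have d_lt : d < m.*2 by lia.
have m_lt : m < d by lia.
have [w wE] : exists w, W = N.of_nat w by exists (N.to_nat W); rewrite N2Nat.id.
have [sc scE] : exists sc, scale = N.of_nat sc by exists (N.to_nat scale); rewrite N2Nat.id.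
subst W scale; pose f j := N.to_nat (nth 0%num phi j).
have f0 j : c < j -> f j = 0 by move=> cj; rewrite /f nth_default // sp.
have fstep j : j < c -> f j.+1 <= f j /\ w <= j * f j + f j.+1.
  move=> jc; have := adjp j; rewrite sp ltnS => /(_ jc) /andP[/N.leb_le h1 /N.leb_le h2].
  split; first by rewrite /f; lia.
  have : w <= N.to_nat ((0 + N.of_nat j) * nth 0%num phi j + nth 0%num phi j.+1)%num by lia.
  by rewrite N2Nat.inj_add N2Nat.inj_mul N.add_0_l Nat2N.id.
have anti : antitone f.
  move=> i j ij; rewrite -(subnK ij); elim: (j - i) => // n IH; apply: leq_trans IH.
  have [nc|nc] := ltnP (n + i) c; first by case: (fstep _ nc).
  by rewrite addSn f0.
have lastp : last 0%num phi = nth 0%num phi c by rewrite (last_nth 0%num) sp.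
have lastu : last 0%num u = nth 0%num u c by rewrite (last_nth 0%num) su.
have topf : w <= (if m == c.*2.+1 then 2 * (c * f c) else c * f c).
  rewrite lastp in topp; have <- : (N.of_nat m =? 2 * N.of_nat c + 1)%num = (m == c.*2.+1) by lia.
  have /leq_trans : w <= N.to_nat (if (N.of_nat m =? 2 * N.of_nat c + 1)%num
    then 2 * (N.of_nat c * nth 0%num phi c) else N.of_nat c * nth 0%num phi c)%num by lia.
  by apply; case: ifP => _; rewrite !N2Nat.inj_mul Nat2N.id.
exists w, f; split.
  split=> //.
  - move=> k km; have [kc|kc] := ltnP k c; first by case: (fstep _ kc).
    have -> : k = c by lia.
    rewrite (f0 c.+1) // addn0; move: topf; have -> : (m == c.*2.+1) = false by lia.
    by [].
  - move=> k km; have -> : k = c by lia.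
    by move: topf; have -> : (m == c.*2.+1) = true by lia.
  - move=> k km; have -> : k = c by lia.
    (* For even [m] the certificate gives [w <= c * f c], and [c <= 2 * c.-1] because [c >= 2]. *)
    apply/orP; right; move: topf; have -> : (m == c.*2.+1) = false by lia.
    by move/leq_trans; apply; rewrite mulnA leq_mul2r; apply/orP; right; lia.
pose I := (size l).-1.
rewrite -dE; apply: (@tail_criterion m d d_lt m_lt c I w sc f
  (fun j => N.to_nat (nth 0%num u j)) (fun j => N.to_nat (nth 0%num l (j - c)))) => //.
- by rewrite /I; lia.
- by lia.
- by lia.
- by rewrite -lastu; lia.
- move=> j jc; apply: ratio_leN; have := adju j; rewrite su ltnS => /(_ jc).
  by rewrite N.add_0_l.
- by rewrite subnn nth0; lia.
- move=> j /andP[cj jI]; split; first by lia.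
  apply: ratio_leN; have := adjl (j - c); rewrite (_ : N.of_nat c + N.of_nat (j - c) = N.of_nat j)%num; last lia.
  by rewrite -subSn //; apply; rewrite /I in jI; lia.
have -> : \sum_(c.+1 <= j < (c + I).+1) N.to_nat (nth 0%num l (j - c)) = N.to_nat (total (behead l)).
  rewrite to_nat_total size_behead -/I -[c.+1]add0n big_addn.
  rewrite (_ : (c + I).+1 - c.+1 = I) ?big_mkord; last lia.
  apply: eq_bigr => i _; rewrite nth_behead (_ : i + c.+1 - c = i.+1) //; lia.
have := to_nat_weighted (N.of_nat w) (N.of_nat m) (etrans sp (esym su)).
rewrite sp !Nat2N.id => <-.
have := N2Nat.inj_mul (N.of_nat w) (total (behead l)); rewrite Nat2N.id; lia.
Qed.

Lemma all_range_from (P : N -> bool) k n : all P (range_from k n) -> forall i, i < n -> P (k + N.of_nat i)%num.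
Proof.
elim: n k => //= n IH k /andP[Pk Ps] [_|i lt]; first by rewrite N.add_0_r.
rewrite (_ : (k + _)%num = (k + 1 + N.of_nat i)%num); last lia.
exact: IH.
Qed.

Lemma certified_all :
  all (fun m => (m =? 23) || (m =? 47) || certified m)%num (range_from 5 355).
Proof. by vm_cast_no_check (erefl true). Qed.

Lemma medium_orders m : 5 <= m < 360 -> m != 23 -> m != 47 ->
  exists W f, admissible W m f /\
    m.*2 * draw_sum m.*2.-1 (m + m %/ 24 + 1) m f < W * 'C(m.*2.-1, m).
Proof.
case/andP=> m5 m360 m23 m47; have := all_range_from certified_all (i := m - 5).
rewrite (_ : (5 + _)%num = N.of_nat m); last lia.
move/(_ ltac:(lia)); rewrite (_ : (N.of_nat m =? 23)%num = false); last lia.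
rewrite (_ : (N.of_nat m =? 47)%num = false); last lia.
exact: certificate_sound.
Qed.

(** * Orders m >= 360 *)

(* The weights f j = W / j with W = c! are exact. Below c the terms of the mean of
   the potential decay at least geometrically with ratio 11/13, so their sum is at
   most 13/2 times the term at c; it remains to see that the total mass exceeds
   the mass at c by a factor of 27. *)
Section Large.
Variable m : nat.
Hypothesis m_large : 360 <= m.
Let c := (m - 1) %/ 2.
Let d := m + m %/ 24 + 1.
Let W := c`!.
Let f j := if j <= c then W %/ maxn j 1 else 0.

Lemma reciprocal_mul j : 0 < j <= c -> j * f j = W.
Proof.
case/andP=> j0 jc; rewrite /f jc (_ : maxn j 1 = j); last lia.
by rewrite mulnC divnK // dvdn_fact // j0.
Qed.

Lemma reciprocal_admissible : admissible W m f.
Proof.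
have m0 := m_large; split.
- move=> i j ij; rewrite /f; case: (leqP j c) => // jc; rewrite (leq_trans ij jc).
  by apply: leq_div2l; lia.
- move=> [|k] km; first by rewrite mul0n add0n /f (_ : 1 <= c) ?divn1 // /c; lia.
  by rewrite reciprocal_mul ?leq_addr // /c; lia.
- move=> k km; rewrite reciprocal_mul ?leq_pmull //; rewrite /c; lia.
- move=> k km; apply/orP; right; have kc : k = c by rewrite /c; lia.
  have := @reciprocal_mul c; rewrite kc => <-; last by rewrite /c; lia.
  by rewrite mulnA leq_mul2r; apply/orP; right; rewrite /c; lia.
Qed.

Lemma m_lt_d : m < d. Proof. by rewrite /d; lia. Qed.
Lemma d_lt_order : d < m.*2. Proof. by have := m_large; rewrite /d; lia. Qed.
Local Notation h := (hypergeom m d).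

(** By [hypergeom_ratio] the ratio of consecutive terms splits into [A / (d - j)] and
    [j.+1 ^ 2 / (j * (m - j))]. Near [j = m/2] the first is about 11m/24 over 13m/24, and the second
    is at most 1 because [m - j >= j + 3]. *)
Lemma geometric j : 0 < j < c -> 13 * (h j * f j) <= 11 * (h j.+1 * f j.+1).
Proof.
case/andP=> j0 jc; have m0 := m_large.
have jm : j < m by rewrite /c in jc; lia.
have := hypergeom_ratio d_lt_order m_lt_d jm; have e1 := @reciprocal_mul j; have e2 := @reciprocal_mul j.+1.
have {}e1 : j * f j = W by apply: e1; lia.
have {}e2 : j.+1 * f j.+1 = W by apply: e2; lia.
set A := m.*2.-1 - d + j.+1 - m => ratio.
have hA : 13 * A <= 11 * (d - j) by rewrite /A /c in jc *; rewrite /d; lia.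
have hj : j.+1 * j.+1 <= j * (m - j).
  have : j + 3 <= m - j by rewrite /c in jc; lia.
  by move: (m - j) => x; nia.
have p0 : 0 < j * j.+1 * ((d - j) * (m - j)) by rewrite !muln_gt0 /d; lia.
rewrite -(leq_pmul2l p0).
have -> : j * j.+1 * ((d - j) * (m - j)) * (13 * (h j * f j)) =
    13 * j.+1 * ((d - j) * (m - j) * h j) * (j * f j) by lia.
have -> : j * j.+1 * ((d - j) * (m - j)) * (11 * (h j.+1 * f j.+1)) =
    11 * j * ((d - j) * (m - j)) * h j.+1 * (j.+1 * f j.+1) by lia.
rewrite -ratio e1 e2 leq_mul2r; apply/orP; right.
have -> : 13 * j.+1 * (j.+1 * A * h j.+1) = (13 * A) * (j.+1 * j.+1) * h j.+1 by lia.
have -> : 11 * j * ((d - j) * (m - j)) * h j.+1 = (11 * (d - j)) * (j * (m - j)) * h j.+1 by lia.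
by rewrite leq_mul2r leq_mul ?orbT.
Qed.

Lemma sum_geometric : 2 * (\sum_(j < m.+1) h j * f j) <= 13 * (h c * f c).
Proof.
have m0 := m_large; have cm : c <= m by rewrite /c; lia.
rewrite (sum_split (fun j => h j * f j) cm) [X in 2 * (_ + X) <= _]big_nat_cond
  [X in 2 * (_ + X) <= _]big1 ?addn0; last first.
  by move=> j; rewrite andbT => /andP[cj _]; rewrite /f leqNgt cj muln0.
have c0 : 0 < c by rewrite /c; lia.
suff H k : 0 < k <= c -> 2 * (\sum_(j < k.+1) h j * f j) <= 13 * (h k * f k).
  by apply: H; rewrite c0 leqnn.
elim: k => // k IH /andP[_ kc].
rewrite big_ord_recr /=; have [->|k0] := posnP k.
  rewrite big_ord1 /= (_ : h 0 = 0) ?mul0n ?add0n ?leq_mul2r ?orbT //.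
  by rewrite /hypergeom bin0 mul1n bin_small // /d; lia.
have := IH; rewrite k0 (ltnW kc) => /(_ isT).
have := @geometric k; rewrite k0 kc => /(_ isT).
(* Twice the previous partial sum is at most 13 times its last term, hence at most 11 times the new
   term; the new term adds 2 more. *)
by move: (h k * f k) (h k.+1 * f k.+1) (\sum_(_ < _) _) => x y z; lia.
Qed.

(* Entry i is a lower bound for 1000 * h (c + i) / h c, valid for all m >= 360. *)
Definition growth :=
  [:: 1000; 1181; 1372; 1559; 1733; 1884; 2003; 2083; 2119; 2108;
      2051; 1951; 1815; 1652; 1470; 1279].

(** Replaces the rounded quotients in [c] and [d] by bounds linear in [m], scaled by 2 and by 24;
    the product 48 is cancelled at the end. *)
Lemma growth_step i t t' : i <= 15 ->
  t' * (m + 1 + 2 * i) * (11 * m + 24 * i - 13) <= t * (13 * m + 12 - 24 * i) * (m + 1 - 2 * i) ->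
  (c + i).+1 * (m.*2.-1 - d + (c + i).+1 - m) * t' <= (d - (c + i)) * (m - (c + i)) * t.
Proof.
move=> i15 H; have m0 := m_large.
have a1 : 2 * (c + i).+1 <= m + 1 + 2 * i by rewrite /c; lia.
have a2 : 24 * (m.*2.-1 - d + (c + i).+1 - m) <= 11 * m + 24 * i - 13 by rewrite /c /d; lia.
have a3 : 13 * m + 12 - 24 * i <= 24 * (d - (c + i)) by rewrite /c /d; lia.
have a4 : m + 1 - 2 * i <= 2 * (m - (c + i)) by rewrite /c; lia.
have h1 := leq_mul (leqnn t') (leq_mul a1 a2); have h2 := leq_mul (leqnn t) (leq_mul a3 a4).
move: h1 h2; set x := _ - m; set y := d - _; set z := m - _; set w := (c + i).+1 => h1 h2.
have {}H : t' * ((m + 1 + 2 * i) * (11 * m + 24 * i - 13)) <= t * ((13 * m + 12 - 24 * i) * (m + 1 - 2 * i)).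
  by rewrite !mulnA.
have := leq_trans h1 (leq_trans H h2); move: x y z w {h1 h2 H a1 a2 a3 a4} => x y z w h.
by rewrite -(leq_pmul2l (isT : 0 < 48)); lia.
Qed.

Lemma growth_table i : i < 15 ->
  (c + i).+1 * (m.*2.-1 - d + (c + i).+1 - m) * nth 0 growth i.+1 <=
  (d - (c + i)) * (m - (c + i)) * nth 0 growth i.
Proof.
move=> i15; apply: growth_step; first lia.
(* The inequalities are quadratic in [m]; with [sq] they become linear in [m] and [m * m]. *)
have m0 := m_large; have sq : 360 * m <= m * m by rewrite leq_mul2r m0 orbT.
do 15 (case: i i15 => [_|i i15]; first by rewrite /=; lia).
by lia.
Qed.

Lemma large_orders : exists W f, admissible W m f /\
    m.*2 * draw_sum m.*2.-1 d m f < W * 'C(m.*2.-1, m).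
Proof.
exists W, f; split; first exact: reciprocal_admissible.
have m0 := m_large; have cm : c + 15 <= m by rewrite /c; lia.
have hc0 : 0 < h c by rewrite /hypergeom muln_gt0 !bin_gt0 /c /d; lia.
have low := @hypergeom_lower m d d_lt_order m_lt_d c 1000 15 (fun j => nth 0 growth (j - c)) cm.
rewrite subnn in low; have {low} := low isT.
have pos j : c <= j < c + 15 -> 0 < m.*2.-1 - d + j.+1 - m /\
    j.+1 * (m.*2.-1 - d + j.+1 - m) * nth 0 growth (j.+1 - c) <=
      (d - j) * (m - j) * nth 0 growth (j - c).
  move=> cj; split; first by rewrite /c /d in cj *; lia.
  by have := @growth_table (j - c); rewrite subnKC ?subSn; [apply|..]; lia.
move/(_ pos) => low.
(* The 16 entries of [growth] add up to 27260. *)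
have big : 27 * 1000 * h c <= 1000 * \sum_(j < m.+1) h j.
  apply: (@leq_trans (1000 * \sum_(c <= j < c + 16) h j)); last first.
    rewrite leq_mul2l -(big_mkord predT h) [leqRHS](big_cat_nat (n := c)) //=; last lia.
    rewrite [X in _ <= _ + X](big_cat_nat (n := c + 16)) /=; try lia.
  rewrite [leqRHS]big_distrr.
  apply: (@leq_trans (\sum_(c <= j < c + 16) nth 0 growth (j - c) * h c)); last first.
    by rewrite [leqLHS]big_nat_cond [leqRHS]big_nat_cond; apply: leq_sum => j; rewrite andbT => cj; apply: low; lia.
  have shift : \sum_(c <= j < c + 16) nth 0 growth (j - c) = \sum_(0 <= i < 16) nth 0 growth i.
    by rewrite -{1}[c]add0n big_addn addKn; apply: eq_bigr => i _; rewrite addnK.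
  rewrite -big_distrl leq_mul2r; apply/orP; right; rewrite [leqRHS]shift.
  by rewrite unlock /=; lia.
rewrite (draw_sum_hypergeom m d f) -(sum_hypergeom d_lt_order m_lt_d) -muln2 -mulnA.
have c0 : 0 < c by rewrite /c; lia.
rewrite -(ltn_pmul2l c0); apply: (@leq_ltn_trans (c * (m * (13 * (h c * f c))))).
  by rewrite !leq_mul2l sum_geometric !orbT.
have -> : c * (m * (13 * (h c * f c))) = W * (13 * m * h c).
  by rewrite -(@reciprocal_mul c) ?c0 ?leqnn //; lia.
rewrite [ltnRHS]mulnCA ltn_pmul2l ?fact_gt0 //.
(* What remains is [13 * m < 27 * c], up to the factor [h c]; it follows from [m <= 2 * c + 2] once
   [c > 26]. *)
have cm2 : m <= 2 * c + 2 by rewrite /c; lia.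
have c26 : 179 <= c by rewrite /c; lia.
by move: (\sum_(_ < _) _) (h c) big hc0 => s x; nia.
Qed.
End Large.

(** * The two exceptional orders *)

Definition table (s : seq N) (j : nat) : nat := N.to_nat (nth 0%num s j).

Section Computation.
Local Open Scope N_scope.

Definition side_weightN (s : seq N) (k r : nat) : N :=
  N.of_nat (k + 1 - r)%N * nth 0 s k + N.of_nat (minn (k + r)%N (2 * r - 1)%N) * nth 0 s k.+1.

Definition side_weights_ok (W : N) (m : nat) (excluded : nat -> nat -> bool) (s : seq N) : bool :=
  all (fun k => all (fun r => (m < k + r)%N || excluded k r ||
      (W <=? side_weightN s k r + side_weightN s (m - (k + r)) r))
    (iota 1%N m)) (iota 0%N m).

Fixpoint next_row (x : N) (s : seq N) : seq N :=
  if s is y :: s' then (x + y) :: next_row y s' else [:: x].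

Fixpoint pascal (n : nat) : seq N := if n is n'.+1 then next_row 0 (pascal n') else [:: 1].

Definition draw_weights (a n y : nat) : seq N :=
  let r := pascal n in let r' := pascal (a - n)%N in
  map (fun j => nth 0 r j * nth 0 r' (y - j)%N) (iota 0%N y.+1).

Fixpoint dot (c s : seq N) : N :=
  match c, s with x :: c', y :: s' => x * y + dot c' s' | _, _ => 0 end.

(* Iterating correlate evaluates the nested sums of strata_sum: entry i of the
   result is the sum of c_j * s_(i+j) over j. *)
Fixpoint correlate (c s : seq N) : seq N :=
  if s is _ :: s' then dot c s :: correlate c s' else [::].

(** The loop over [n3] is outermost so that [s3] is shared by all [n2]; [n1] is then determined by
    [d]. The test is an [if] so that call-by-value evaluation skips the discarded splits. *)
Definition strata_bounded (a y : nat * nat * nat) (d : nat) (allowed : nat -> nat -> bool)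
    (bound : N) (s : seq N) : bool :=
  all (fun n3 => let s3 := correlate (draw_weights a.2 n3 y.2) s in
    all (fun n2 => let n1 := (d - n2 - n3)%N in
      if [|| (d < n2 + n3)%N, (a.1.1 < n1)%N | ~~ allowed n1 n2] then true else
      dot (draw_weights a.1.1 n1 y.1.1) (correlate (draw_weights a.1.2 n2 y.1.2) s3) <=? bound)
    (iota 0%N a.1.2.+1)) (iota 0%N a.2.+1).
(* The weight 9000/10^6 at c = (m-1)/2 is too small to exclude the obstructions
   with k = l = c and r = 1, and sufficient for all the others. *)
Definition small_table (W m : N) : seq N :=
  let c := (m - 1) / 2 in phi_below W (N.to_nat c) (c - 1) 9000 [:: 9000].

(* bS, bT, bR bound the contribution of a vertex of S, T and of the rest R, for the
   worst distribution of its neighbours over the strata; b0 and b1 do so for a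
   vertex of S with no and at most one out-neighbour in T (and dually for T). *)
Definition exceptional (W : N) (m d t q : nat) (s s' : seq N) (b0 b1 bS bT bR : N) : bool :=
  let y := (t, t, q) in
  let aS := (t.*2.-1, t.*2, q.*2) in
  let aT := (t.*2, t.*2.-1, q.*2) in
  let aR := (t.*2, t.*2, q.*2.-1) in
  [&& (m == t.*2 + q)%N, (q.+1 == t.*2)%N, adjacent (fun _ x y => y <=? x) 0 s,
      adjacent (fun _ x y => y <=? x) 0 s',
      side_weights_ok W m (fun k r => (k == t.*2.-1) && (r == 1%N)) s',
      N.of_nat m.*2 * dot (draw_weights m.*2.-1 d m) s' <? W * nth 0 (pascal m.*2.-1) m,
      side_weights_ok W m (fun _ _ => false) s,
      strata_bounded aS y d (fun _ n2 => n2 == 0%N) b0 s,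
      strata_bounded aS y d (fun _ n2 => n2 <= 1)%N b1 s,
      strata_bounded aS y d (fun _ _ => true) bS s,
      strata_bounded aT y d (fun n1 _ => n1 == 0%N) b0 s,
      strata_bounded aT y d (fun n1 _ => n1 <= 1)%N b1 s,
      strata_bounded aT y d (fun _ _ => true) bT s,
      strata_bounded aR y d (fun _ _ => true) bR s &
      let t2 := N.of_nat t.*2 in let q2 := N.of_nat q.*2 in
      2 * (t2 * b0 + (b1 - b0)) + t2 * (bS + bT) + 2 * (q2 * bR) <?
      W * (nth 0 (pascal t.*2) t * nth 0 (pascal t.*2) t * nth 0 (pascal q.*2) q)].
End Computation.

Lemma side_weightNE s k r : N.to_nat (side_weightN s k r) = side_weight (table s) k r.
Proof. by rewrite /side_weightN N2Nat.inj_add !N2Nat.inj_mul !Nat2N.id. Qed.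

Lemma side_weights_okP W m excluded s : side_weights_ok W m excluded s ->
  forall k l r, k + l + r = m -> 0 < r ->
  excluded k r \/ N.to_nat W <= side_weight (table s) k r + side_weight (table s) l r.
Proof.
move=> /allP ok k l r E r0; have := ok k; rewrite mem_iota => /(_ ltac:(lia)) /allP /(_ r).
rewrite mem_iota => /(_ ltac:(lia)); rewrite (_ : (m < k + r) = false) /=; last lia.
case/orP=> [|/N.leb_le le]; [by left | right].
by rewrite -!side_weightNE (_ : l = m - (k + r)); lia.
Qed.

Lemma nth_next_row x s j : nth 0%num (next_row x s) j = (nth 0 (x :: s) j + nth 0 s j)%num.
Proof.
elim: s x j => [|y s IH] x [|j] /=; rewrite ?N.add_0_r ?nth_nil ?IH //.
Qed.

Lemma pascalE n j : N.to_nat (nth 0%num (pascal n) j) = 'C(n, j).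
Proof.
elim: n j => [|n IH] [|j] //=; rewrite ?nth_next_row ?nth_nil //.
  by rewrite N2Nat.inj_add IH !bin0.
by rewrite N2Nat.inj_add /= !IH binS addnC.
Qed.

Lemma dotE c s : N.to_nat (dot c s) = \sum_(j < size c) N.to_nat (nth 0%num c j) * table s j.
Proof.
elim: c s => [|x c IH] [|y s] /=; rewrite ?big_ord0 //.
  by rewrite big1 // => j _; rewrite /table nth_nil muln0.
by rewrite big_ord_recl N2Nat.inj_add N2Nat.inj_mul IH.
Qed.

Lemma table_correlate c s i : table (correlate c s) i = N.to_nat (dot c (drop i s)).
Proof.
rewrite /table; elim: s i => [|y s IH] [|i] //=; by case: c.
Qed.

Lemma draw_dot a n y s : N.to_nat (dot (draw_weights a n y) s) = draw_sum a n y (table s).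
Proof.
rewrite dotE size_map size_iota; apply: eq_bigr => j _; congr (_ * _).
by rewrite (nth_map 0) ?size_iota // nth_iota // add0n N2Nat.inj_mul !pascalE.
Qed.

Lemma draw_correlate a n y s i :
  draw_sum a n y (fun j => table s (i + j)) = table (correlate (draw_weights a n y) s) i.
Proof.
by rewrite table_correlate draw_dot; apply: eq_draw_sum => j; rewrite /table nth_drop.
Qed.

Lemma strata_boundedP a y d allowed bound s : strata_bounded a y d allowed bound s ->
  forall n1 n2 n3, n1 <= a.1.1 -> n2 <= a.1.2 -> n3 <= a.2 -> n1 + n2 + n3 = d ->
  allowed n1 n2 -> strata_sum a (n1, n2, n3) y (table s) <= N.to_nat bound.
Proof.
move=> /allP ok n1 n2 n3 h1 h2 h3 E al; have := ok n3; rewrite mem_iota => /(_ ltac:(lia)) /allP /(_ n2).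
rewrite mem_iota => /(_ ltac:(lia)); cbv zeta; rewrite (_ : d - n2 - n3 = n1); last lia.
case: ifP => [|_ /N.leb_le le]; first by rewrite al orbF => /orP[]; lia.
rewrite /strata_sum; cbn [fst snd].
rewrite (@eq_draw_sum _ _ _ _ (table (correlate (draw_weights a.1.2 n2 y.1.2)
   (correlate (draw_weights a.2 n3 y.2) s)))).
  by rewrite -draw_dot; lia.
move=> i; rewrite -draw_correlate; apply: eq_draw_sum => j.
by rewrite -draw_correlate.
Qed.

Lemma adjacent_antitone s : adjacent (fun _ x y => y <=? x)%num 0%num s -> antitone (table s).
Proof.
move=> adj i j ij; rewrite -(subnK ij); elim: (j - i) => // n IH; apply: leq_trans IH.
rewrite addSn /table; have [lt|ge] := ltnP (n + i).+1 (size s).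
  by have /N.leb_le := adjacentP adj lt; lia.
by rewrite [nth _ _ (_.+1)]nth_default.
Qed.

(** * Two-factors from averages of the potential *)

Section Partition.
Variables (V : finType) (e : rel V).
Implicit Types (X S T : {set V}).

Definition has_2factor X : bool := [forall S : {set V}, forall T : {set V},
  (S \subset X) && (T \subset ~: X) ==>
  (2 * (#|S| + #|T|) <= #|arcs e S T| + 2 * #|~: X|)].

Lemma has_2factorPn X : reflect (exists S T, [/\ S \subset X, T \subset ~: X &
  #|arcs e S T| + 2 * #|~: X| < 2 * (#|S| + #|T|)]) (~~ has_2factor X).
Proof.
apply: (iffP idP) => [|[S [T [SX TX lt]]]].
  rewrite negb_forall => /existsP[S]; rewrite negb_forall => /existsP[T].
  by rewrite negb_imply -ltnNge => /andP[/andP[SX TX] lt]; exists S, T.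
apply/forallP => /(_ S) /forallP /(_ T); rewrite SX TX /=.
by rewrite leqNgt lt.
Qed.

Lemma weight_le_potential phi W m X : antitone phi ->
  (forall k l r, k + l + r = m -> 0 < r -> W <= side_weight phi k r + side_weight phi l r) ->
  #|X| = #|~: X| -> #|X| = m -> ~~ has_2factor X -> W <= potential e phi X.
Proof.
move=> anti wt cX cm /has_2factorPn[S [T [SX TX lt]]].
rewrite -cX cm in lt; have cY : #|~: X| = m by rewrite -cX.
have [k [l [r [S' [T' [[E r0 _ _] _ _]]]]]] := obstruction_potential anti cm cY SX TX lt.
exact: leq_trans (wt k l r E r0).
Qed.

Lemma half_card m X : #|V| = m.*2 -> #|X| = #|~: X| -> #|X| = m.
Proof. by move=> cV cX; have := cardsC X; rewrite -cX cV; lia. Qed.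

(** If every balanced [X] were obstructed, each would have potential at least [W], against the mean
    bounded by [uniform_average]. *)
Lemma admissible_2factor m d W phi : irreflexive e -> #|V| = m.*2 -> 0 < m ->
  (forall v, d <= #|[set w | e v w]|) -> (forall v, d <= #|[set w | e w v]|) ->
  admissible W m phi -> m.*2 * draw_sum m.*2.-1 d m phi < W * 'C(m.*2.-1, m) ->
  exists2 X : {set V}, #|X| = #|~: X| & has_2factor X.
Proof.
case: m => // m irr cV _ dout din [anti step odd_top even_top] small.
case: (boolP [exists X : {set V}, (#|X| == #|~: X|) && has_2factor X]).
  by case/existsP => X /andP[/eqP cX hX]; exists X.
rewrite negb_exists => /forallP none.
have low (X : {set V}) : #|X| = #|~: X| -> W <= potential e phi X.
  move=> cX; apply: (weight_le_potential anti _ cX (half_card cV cX)).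

    exact: side_weight_total.
  by have := none X; rewrite cX eqxx.
by have := uniform_average irr cV anti dout din low; rewrite leqNgt; move: small; rewrite doubleS => ->.
Qed.

Variables (S T : {set V}) (m d t q : nat) (W b0 b1 bS bT bR : N) (s s' : seq N).
Hypothesis cert : exceptional W m d t q s s' b0 b1 bS bT bR.
Hypothesis cV : #|V| = m.*2.
Hypotheses (cS : #|S| = t.*2) (cT : #|T| = t.*2) (dis : S :&: T = set0).
Let R := ~: (S :|: T).

Lemma exceptional_part v : (v \in S) + (v \in T) + (v \in R) = 1.
Proof.
have := congr1 (fun A : {set V} => v \in A) dis; rewrite /R !inE; by case: (v \in S); case: (v \in T).
Qed.

Lemma card_rest : #|R| = q.*2.
Proof.
case/andP: cert => /eqP E _; have := cardsC (S :|: T); rewrite cardsU dis cards0 cS cT cV -/R.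
by lia.
Qed.

(** The last two bounds are written as linear functions of the number of neighbours in the other
    set, so that they can be summed against the at most one arc from [S] to [T]. *)
Lemma exceptional_vertex v (N : {set V}) : #|N| = d -> v \notin N ->
  let x := vertex_sum S T R t t q (table s) v N in
  [/\ v \in S -> x <= N.to_nat bS, v \in T -> x <= N.to_nat bT, v \in R -> x <= N.to_nat bR,
      v \in S -> #|T :&: N| <= 1 -> x <= N.to_nat b0 + (N.to_nat b1 - N.to_nat b0) * #|T :&: N| &
      v \in T -> #|S :&: N| <= 1 -> x <= N.to_nat b0 + (N.to_nat b1 - N.to_nat b0) * #|S :&: N|].
Proof.
move=> cN vN x.
have sum_d : #|(S :\ v) :&: N| + #|(T :\ v) :&: N| + #|(R :\ v) :&: N| = d.
  rewrite -(card_meet_union exceptional_part N (subsetDl _ _) (subsetDl _ _) (subsetDl _ _)) -cN.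
  apply: eq_card => w; rewrite !inE; case: (boolP (w \in N)); rewrite ?andbF // andbT => wN.
  have -> /= : w != v by apply: contraNneq vN => <-.
  by case: (w \in S); case: (w \in T).
have cS1 := cardsD1 v S; have cT1 := cardsD1 v T; have cR1 := cardsD1 v R.
rewrite cS in cS1; rewrite cT in cT1; rewrite card_rest in cR1.
have p := exceptional_part v.
have le1 := subset_leq_card (subsetIl (S :\ v) N); have le2 := subset_leq_card (subsetIl (T :\ v) N).
have le3 := subset_leq_card (subsetIl (R :\ v) N).
case/andP: cert => _ /andP[_ /andP[_ /andP[_ /andP[_ /andP[_ /andP[_]]]]]].
case/andP=> /strata_boundedP S0 /andP[/strata_boundedP S1 /andP[/strata_boundedP SS]].
case/andP=> /strata_boundedP T0 /andP[/strata_boundedP T1 /andP[/strata_boundedP TT /andP[/strata_boundedP RR _]]].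
have drop_v A : (A :\ v) :&: N = A :&: N.
  apply/setP=> w; rewrite !inE; case: (boolP (w \in N)); rewrite ?andbF // => wN.
  by rewrite (_ : w != v) //; apply: contraNneq vN => <-.
rewrite /x /vertex_sum; split=> vA.
- have [-> -> ->] : [/\ #|S :\ v| = t.*2.-1, #|T :\ v| = t.*2 & #|R :\ v| = q.*2] by split; lia.
  by apply: SS; rewrite /=; lia.
- have [-> -> ->] : [/\ #|S :\ v| = t.*2, #|T :\ v| = t.*2.-1 & #|R :\ v| = q.*2] by split; lia.
  by apply: TT; rewrite /=; lia.
- have [-> -> ->] : [/\ #|S :\ v| = t.*2, #|T :\ v| = t.*2 & #|R :\ v| = q.*2.-1] by split; lia.
  by apply: RR; rewrite /=; lia.
- have [-> -> ->] : [/\ #|S :\ v| = t.*2.-1, #|T :\ v| = t.*2 & #|R :\ v| = q.*2] by split; lia.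
  rewrite -(drop_v T); move=> h1; have [z|nz] := eqVneq #|(T :\ v) :&: N| 0.
    by rewrite {2}z muln0 addn0; apply: S0; rewrite /= ?z; lia.
  have {2}-> : #|(T :\ v) :&: N| = 1 by lia.
  by apply: leq_trans (S1 _ _ _ _ _ _ _ _) _; rewrite /=; lia.
- have [-> -> ->] : [/\ #|S :\ v| = t.*2, #|T :\ v| = t.*2.-1 & #|R :\ v| = q.*2] by split; lia.
  rewrite -(drop_v S); move=> h1; have [z|nz] := eqVneq #|(S :\ v) :&: N| 0.
    by rewrite {2}z muln0 addn0; apply: T0; rewrite /= ?z; lia.
  have {2}-> : #|(S :\ v) :&: N| = 1 by lia.
  by apply: leq_trans (T1 _ _ _ _ _ _ _ _) _; rewrite /=; lia.
Qed.

Hypothesis irr : irreflexive e.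
Hypothesis dout : forall v, d <= #|[set w | e v w]|.
Hypothesis din : forall v, d <= #|[set w | e w v]|.

Lemma sum_strata (F : V -> nat) :
  \sum_v F v = \sum_(v in S) F v + \sum_(v in T) F v + \sum_(v in R) F v.
Proof.
rewrite [X in _ = X + _ + _]big_mkcond [X in _ = _ + X + _]big_mkcond [X in _ = _ + _ + X]big_mkcond.
rewrite -!big_split /=; apply: eq_bigr => v _; have := exceptional_part v.
by case: (v \in S); case: (v \in T); case: (v \in R); rewrite ?addn0.
Qed.

Lemma sum_few (A B : {set V}) (Nb : V -> {set V}) (F : V -> nat) : #|A| = t.*2 ->
  (forall v, v \in A -> #|B :&: Nb v| <= 1 ->
     F v <= N.to_nat b0 + (N.to_nat b1 - N.to_nat b0) * #|B :&: Nb v|) ->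
  \sum_(v in A) #|B :&: Nb v| <= 1 ->
  \sum_(v in A) F v <= t.*2 * N.to_nat b0 + (N.to_nat b1 - N.to_nat b0).
Proof.
move=> cA FA few.
apply: (@leq_trans (\sum_(v in A) (N.to_nat b0 + (N.to_nat b1 - N.to_nat b0) * #|B :&: Nb v|))).
  apply: leq_sum => v vA; apply: FA => //.
  by apply: leq_trans few; rewrite (bigD1 v) //= leq_addr.
rewrite big_split sum_nat_const cA -big_distrr leq_add2l.
by rewrite -[leqRHS]muln1 leq_mul2l few orbT.
Qed.

(** Averages over the sets that halve [S], [T] and [R]. At most one vertex of [S], for out-degrees,
    and one of [T], for in-degrees, costs [b1] instead of [b0]. *)
Lemma exceptional_contradiction :
  #|arcs e S T| <= 1 -> (forall X, #|X| = #|~: X| -> ~~ has_2factor X) -> False.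
Proof.
move=> few none.
pose out v := trim d [set w | e v w]; pose inn v := trim d [set w | e w v].
have co v : #|out v| = d by apply: card_trim.
have ci v : #|inn v| = d by apply: card_trim.
have vo v : v \notin out v by apply/negP => /mem_trim; rewrite inE irr.
have vi v : v \notin inn v by apply/negP => /mem_trim; rewrite inE irr.
have few_out : \sum_(v in S) #|T :&: out v| <= 1.
  apply: leq_trans few; rewrite card_arcs; apply: leq_sum => v _.
  apply/subset_leq_card/subsetP => w; rewrite in_setI => /andP[wT /mem_trim].
  by rewrite !inE wT.
have few_in : \sum_(v in T) #|S :&: inn v| <= 1.
  apply: leq_trans few; rewrite card_arcs_converse_sum; apply: leq_sum => v _.
  apply/subset_leq_card/subsetP => w; rewrite in_setI => /andP[wT /mem_trim].
  by rewrite !inE wT.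
have bo v := exceptional_vertex (co v) (vo v); have bi v := exceptional_vertex (ci v) (vi v).
case/andP: cert => /eqP mE /andP[_ /andP[/adjacent_antitone anti /andP[_ /andP[_ /andP[_]]]]].
case/andP=> /side_weights_okP wt /andP[_ /andP[_ /andP[_ /andP[_ /andP[_ /andP[_ /andP[_]]]]]]].
move/N.ltb_lt => key.
have low X : #|X| = #|~: X| -> N.to_nat W <= potential e (table s) X.
  move=> cX; apply: (weight_le_potential anti _ cX (half_card cV cX)); last exact: none.
  by move=> k l r E r0; case: (wt k l r E r0).
have := strata_average cS cT card_rest exceptional_part anti (fun v => trim_sub d _) (fun v => trim_sub d _) low.
rewrite !sum_strata -/out -/inn.
have h1 := sum_few cS (fun v vS => let: And5 _ _ _ h _ := bo v in h vS) few_out.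
have h2 := sum_few cT (fun v vT => let: And5 _ _ _ _ h := bi v in h vT) few_in.
have sum_le (A : {set V}) n (F : V -> nat) B : #|A| = n -> (forall v, v \in A -> F v <= B) ->
    \sum_(v in A) F v <= n * B.
  by move=> <- FB; rewrite -sum_nat_const; apply: leq_sum.
have h3 : \sum_(v in T) vertex_sum S T R t t q (table s) v (out v) <= t.*2 * N.to_nat bT.
  by apply: sum_le => // v vT; have [_ h _ _ _] := bo v; apply: h.
have h4 : \sum_(v in R) vertex_sum S T R t t q (table s) v (out v) <= q.*2 * N.to_nat bR.
  by apply: sum_le => [|v vR]; [exact: card_rest | have [_ _ h _ _] := bo v; apply: h].
have h5 : \sum_(v in S) vertex_sum S T R t t q (table s) v (inn v) <= t.*2 * N.to_nat bS.
  by apply: sum_le => // v vS; have [h _ _ _ _] := bi v; apply: h.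
have h6 : \sum_(v in R) vertex_sum S T R t t q (table s) v (inn v) <= q.*2 * N.to_nat bR.
  by apply: sum_le => [|v vR]; [exact: card_rest | have [_ _ h _ _] := bi v; apply: h].
move=> lower; have := leq_trans lower (leq_add (leq_add (leq_add h1 h3) h4) (leq_add (leq_add h5 h2) h6)).
have : N.to_nat (2 * (N.of_nat t.*2 * b0 + (b1 - b0)) + N.of_nat t.*2 * (bS + bT) +
     2 * (N.of_nat q.*2 * bR)) < N.to_nat (W *
     (nth 0 (pascal t.*2) t * nth 0 (pascal t.*2) t * nth 0 (pascal q.*2) q))%num by lia.
rewrite !(N2Nat.inj_mul, N2Nat.inj_add, N2Nat.inj_sub) !pascalE !Nat2N.id.
move: (N.to_nat b0) (N.to_nat b1) (N.to_nat bS) (N.to_nat bT) (N.to_nat bR) => x0 x1 xS xT xR.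
move: (N.to_nat W) 'C(t.*2, t) 'C(q.*2, q) => w c1 c2.
have -> : N.to_nat 2 = 2 by [].
by nia.
Qed.

End Partition.

(** The table [s'] comes first: its uniform mean is below [W], so some balanced [X] has smaller
    potential. The obstruction of this [X] is of the excluded kind and supplies [S] and [T]; the
    table [s] then gives the contradiction. *)
Lemma exceptional_2factor (V : finType) (e : rel V) m d t q W b0 b1 bS bT bR s s' :
  exceptional W m d t q s s' b0 b1 bS bT bR -> irreflexive e -> #|V| = m.*2 ->
  (forall v, d <= #|[set w | e v w]|) -> (forall v, d <= #|[set w | e w v]|) ->
  exists2 X : {set V}, #|X| = #|~: X| & has_2factor e X.
Proof.
move=> cert irr cV dout din.
case: (boolP [exists X : {set V}, (#|X| == #|~: X|) && has_2factor e X]).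
  by case/existsP => X /andP[/eqP cX hX]; exists X.
rewrite negb_exists => /forallP none; exfalso.
have {}none (X : {set V}) : #|X| = #|~: X| -> ~~ has_2factor e X.
  by move=> cX; have := none X; rewrite cX eqxx.
case/andP: (cert) => /eqP mE /andP[/eqP tE /andP[_ /andP[/adjacent_antitone anti]]].
case/andP=> /side_weights_okP wt /andP[/N.ltb_lt key _].
case: (boolP [forall X : {set V}, (#|X| == #|~: X|) ==> (N.to_nat W <= potential e (table s') X)]).
  move/forallP => low; have {}low (X : {set V}) : #|X| = #|~: X| -> N.to_nat W <= potential e (table s') X.
    by move=> cX; have := low X; rewrite cX eqxx.
  have : N.to_nat (N.of_nat m.*2 * dot (draw_weights m.*2.-1 d m) s') <
     N.to_nat (W * nth 0%num (pascal m.*2.-1) m) by lia.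
  rewrite !N2Nat.inj_mul pascalE Nat2N.id draw_dot.
  have m0 : 0 < m by lia.
  case: (m) m0 cV => // m' _ cV'; rewrite doubleS /= ltnNge.
  by rewrite (uniform_average irr cV' anti dout din low).
rewrite negb_forall => /existsP[X]; rewrite negb_imply -ltnNge => /andP[/eqP cX lt].
have cm := half_card cV cX; have cY : #|~: X| = m by rewrite -cX.
have /has_2factorPn[S [T [SX TX]]] := none X cX; rewrite cY => viol.
have [k [l [r [S' [T' [[E r0 cS cT] [SX' TX'] few]]]]]] := obstruction_potential anti cm cY SX TX viol.
(* With [k = 2t-1] and [r = 1], both sets have [2t] elements, and fewer than [2 * r = 2] arcs join
   them. *)
case: (wt k l r E r0) => [/andP[/eqP kE /eqP rE] _|le1 le2]; last by lia.
apply: (@exceptional_contradiction V e S' T' m d t q W b0 b1 bS bT bR s s') => //; try lia.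
apply/setP=> v; rewrite !inE; case: (boolP (v \in S')) => //= /(subsetP SX') vX.
by apply/negP => /(subsetP TX'); rewrite inE vX.
Qed.

Lemma exceptional23 : exceptional 1000000 23 24 6 11 (phi_table 1000000 23) (small_table 1000000 23)
  4846430931293952 5572422011019864 7286206666985792 7286206666985792 7032141251083200.
Proof. by vm_cast_no_check (erefl true). Qed.

Lemma exceptional47 : exceptional 1000000 47 49 12 23 (phi_table 1000000 47) (small_table 1000000 47)
  236344718840258728724546340000 253007216714076882708173850600 334445594895565630242347378160
  334445594895565630242347378160 328397029911709751344182381096.
Proof. by vm_cast_no_check (erefl true). Qed.

(** * Orders 2 <= m < 5 and the conclusion for all orders *)

Lemma tiny_orders m : 2 <= m < 5 -> exists W f, admissible W m f /\
    m.*2 * draw_sum m.*2.-1 (m + m %/ 24 + 1) m f < W * 'C(m.*2.-1, m).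
Proof.
(* For [m = 4], where [c = 1], the second alternative for even [m] fails as [c.-1 = 0]. The first
   asks for [W <= 6 * phi 2], so [W = 6] allows [phi 2 = 1]. *)
move=> m25; exists 6, (fun j => if j <= 1 then 6 else if (j == 2) && (m == 4) then 1 else 0).
split; last first.
  case: m m25 => [|[|[|[|[|]]]]] // _;
    rewrite /draw_sum !big_ord_recl big_ord0 /=; vm_compute; reflexivity.
split.
- move=> i j ij; case: (leqP j 1) => j1; first by rewrite (leq_trans ij j1).
  case: (leqP i 1) => i1; first by case: ifP.
  case: ifP => // /andP[/eqP jE ->]; rewrite (_ : i = 2) //; lia.
- by move=> [|[|k]] // km; case: m m25 km => [|[|[|[|[|]]]]] //.
- by move=> [|[|k]] km; move: m25; rewrite km //; lia.
- by move=> [|[|k]] km; move: m25; rewrite km //; lia.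
Qed.

Lemma balanced_2factor (V : finType) (e : rel V) m : irreflexive e -> 0 < m -> #|V| = m.*2 ->
  (forall v, m + m %/ 24 + 1 <= #|[set w | e v w]|) ->
  (forall v, m + m %/ 24 + 1 <= #|[set w | e w v]|) ->
  exists2 X : {set V}, #|X| = #|~: X| & has_2factor e X.
Proof.
move=> irr m0 cV dout din.
(* Out-degrees are at most [2m - 1], which rules out [m = 1]. *)
have m2 : 2 <= m.
  have /card_gt0P[v _] : 0 < #|V| by lia.
  have := dout v; have : [set w | e v w] \subset [set~ v].
    by apply/subsetP => w; rewrite !inE; apply: contraTneq => ->; rewrite irr.
  by move/subset_leq_card; rewrite cardsC1 cV; lia.
have [m23|m23] := eqVneq m 23; first by subst m; exact: exceptional_2factor exceptional23 irr cV dout din.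
have [m47|m47] := eqVneq m 47; first by subst m; exact: exceptional_2factor exceptional47 irr cV dout din.
have [W [f [adm small]]] : exists W f, admissible W m f /\
    m.*2 * draw_sum m.*2.-1 (m + m %/ 24 + 1) m f < W * 'C(m.*2.-1, m).
  have [lt|ge] := ltnP m 5; first by apply: tiny_orders; rewrite m2.
  have [lt|ge'] := ltnP m 360; first by apply: medium_orders; rewrite ?ge.
  exact: large_orders.
exact: admissible_2factor adm small.
Qed.

Lemma min_semidegree_le (D : digraph) (v : D) :
  (min_semidegree D <= outdeg v) && (min_semidegree D <= indeg v).
Proof.
rewrite -leq_min /min_semidegree; have := mem_index_enum v.
elim: (index_enum _) => // u s IH; rewrite big_cons inE => /orP[/eqP <-|/IH]; first exact: geq_minl.
exact: leq_trans (geq_minr _ _).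
Qed.

Import Order.TTheory GRing.Theory Num.Theory.
Local Open Scope ring_scope.

Theorem corollary2 (D : digraph) (n : nat) (order_D : #|D| = n)
  (even_n : ~~ odd n)
  (delta_D : (25%:R / 48%:R) * n%:R < (min_semidegree D)%:R :> rat) :
  exists cs : seq (seq D * seq (D * D)), antidirected_2factor cs.
Proof.
have n0 := vertex_gt0 D; have nE : n = (n./2).*2 by rewrite -[LHS]odd_double_half (negPf even_n).
have delta : (25 * n < 48 * min_semidegree D)%N.
  have h48 : 0 < 48%:R :> rat by rewrite ltr0n.
  rewrite -(ltr_nat rat) !natrM; move: delta_D; rewrite mulrAC (ltr_pdivrMr _ _ h48).
  by move=> h; rewrite [ltRHS]mulrC.
have deg := @min_semidegree_le D.
have [|||||X cX hX] := @balanced_2factor D (@Defs.arc D) n./2.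
- exact: arc_irrefl.
- by lia.
- by rewrite order_D.
(* With [n = 2m], [delta] says that the semidegree exceeds 25m/24, and by integrality it is at least
   [m + m %/ 24 + 1]. *)
- by move=> v; case/andP: (deg v); rewrite /outdeg; lia.
- by move=> v; case/andP: (deg v); rewrite /indeg; lia.
apply: (antidirected_2factor_of_partition cX) => S T SX TX.
by move/forallP/(_ S)/forallP/(_ T): hX; rewrite SX TX.
Qed.
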